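(* Assume, for some $n\ge3$, that $A=\langle v_1,v_2,v_3\rangle\cong C_{2^n}\times C_{2^n}\times C_{2^n}$ (with $v_1,v_2,v_3$ generating the three factors), and that $S=A\langle s,t\rangle$ is an extension of $A$ by $D_8$ (so $A\trianglelefteq S$ and $S/A\cong D_8$), where, with $v^x=x^{-1}vx$, $$v_1^{t}=v_3^{-1},\quad v_2^{t}=v_2^{-1},\quad v_3^{t}=v_1^{-1},\qquad v_1^{s}=v_2,\quad v_2^{s}=v_3,\quad v_3^{s}=v_1v_2^{-1}v_3,$$ and where $t^2=1$ and $s^4\in\langle v_1v_3\rangle$. Then $A$ is normal in every saturated fusion system over $S$. Thus there is no $\Gamma\le\mathrm{Aut}(A)$ with $\mathrm{Aut}_S(A)\in\mathrm{Syl}_2(\Gamma)$ such that $(\Gamma,A)$ is fusion realizable.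
   Context: Fusion systems. For a prime $p$ and a finite $p$-group $S$, a fusion system $\mathcal{F}$ over $S$ is a category whose objects are the subgroups of $S$, whose morphisms are injective homomorphisms (with the usual composition), such that for all $P,Q\le S$ the set $\mathrm{Hom}_{\mathcal F}(P,Q)$ contains all maps $x\mapsto gxg^{-1}$ for $g\in S$ with $gPg^{-1}\le Q$, and such that every morphism is the composite of an $\mathcal F$-isomorphism followed by an inclusion. Subgroups isomorphic in $\mathcal F$ are called $\mathcal F$-conjugate. A subgroup $P\le S$ is fully normalized (fully centralized) if $|N_S(P)|\ge|N_S(Q)|$ (resp. $|C_S(P)|\ge|C_S(Q)|$) for every $Q$ that is $\mathcal F$-conjugate to $P$. $\mathcal F$ is saturated if (1) each fully normalized $P$ is fully centralized and $\mathrm{Aut}_S(P)\in\mathrm{Syl}_p(\mathrm{Aut}_{\mathcal F}(P))$; and (2) each $\varphi\in\mathrm{Iso}_{\mathcal F}(P,Q)$ with $Q$ fully centralized extends to a morphism in $\mathrm{Hom}_{\mathcal F}(N_\varphi,S)$, where $N_\varphi=\{g\in N_S(P)\mid \varphi c_g\varphi^{-1}\in\mathrm{Aut}_S(Q)\}$. Here $c_g(x)=gxg^{-1}$, and $\mathrm{Aut}_S(P)$ is the group of automorphisms of $P$ induced by conjugation by elements of $N_S(P)$. A subgroup $P\le S$ is normal in $\mathcal F$ if each morphism in $\mathrm{Hom}_{\mathcal F}(Q,R)$ extends to a morphism in $\mathrm{Hom}_{\mathcal F}(QP,RP)$ that sends $P$ to itself. Realizability. For a finite abelian $p$-group $A$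 and $\Gamma\le\mathrm{Aut}(A)$, the pair $(\Gamma,A)$ is fusion realizable if there is a saturated fusion system $\mathcal F$ over some finite $p$-group $S'$ with $A\le S'$ such that $C_{S'}(A)=A$, $A$ is not normal in $\mathcal F$, and $\mathrm{Aut}_{\mathcal F}(A)=\Gamma$. *)

(* Defs.v *)
From HB Require Import structures.
From mathcomp Require Import all_boot all_fingroup all_solvable.

Set Implicit Arguments.
Unset Strict Implicit.
Unset Printing Implicit Defensive.

Local Open Scope group_scope.

(* x ^ y is y^-1 * x * y in MathComp, so x ^ g^-1 below is the left conjugation
   c_g (x) = g x g^-1. *)

(* A morphism P -> Q is represented by any function gT -> gT whose restriction
   to P is that morphism (fs_ext), so that composition of morphisms is plain
   composition of functions. *)
Definition is_fiso (gT : finGroupType)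
    (hom : {group gT} -> {group gT} -> pred (gT -> gT))
    (P Q : {group gT}) (f : gT -> gT) : Prop :=
  hom P Q f /\
  exists g, [/\ hom Q P g, {in P, cancel f g} & {in Q, cancel g f}].

Record fusion_system (gT : finGroupType) (S : {group gT}) := FusionSystem {
  fs_hom :> {group gT} -> {group gT} -> pred (gT -> gT);
  fs_obj : forall P Q f, fs_hom P Q f -> P \subset S /\ Q \subset S;
  fs_inj : forall P Q f, fs_hom P Q f ->
    [/\ {in P &, {morph f : x y / x * y}}, {in P &, injective f}
      & {in P, forall x, f x \in Q}];
  fs_ext : forall (P Q : {group gT}) f g,
    {in P, f =1 g} -> fs_hom P Q f -> fs_hom P Q g;
  fs_comp : forall P Q R f g,
    fs_hom P Q f -> fs_hom Q R g -> fs_hom P R (g \o f);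
  (* With g = 1 this gives the identities and the inclusions. *)
  fs_conj : forall (P Q : {group gT}) g,
    P \subset S -> Q \subset S -> g \in S -> P :^ g^-1 \subset Q ->
    fs_hom P Q (fun x => x ^ g^-1);
  (* The composite of an isomorphism f : P -> R with the inclusion of R into Q
     is represented by f itself. *)
  fs_factor : forall P Q f, fs_hom P Q f ->
    exists2 R : {group gT}, R \subset Q & is_fiso fs_hom P R f
}.

Section FusionSystems.

Variables (gT : finGroupType) (S : {group gT}).
Implicit Types (F : fusion_system S) (P Q R : {group gT}).

Definition fconj F P Q : Prop := exists f, is_fiso F P Q f.

Definition fully_normalized F P : Prop :=
  forall Q, fconj F P Q -> #|'N_S(Q)| <= #|'N_S(P)|.

Definition fully_centralized F P : Prop :=
  forall Q, fconj F P Q -> #|'C_S(Q)| <= #|'C_S(P)|.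

Definition AutF F P : {set {perm gT}} := [set a in Aut P | fs_hom F P P a].

(* conj_aut P g is x |-> g^-1 x g; the image is the same as with c_g. *)
Definition AutS P : {set {perm gT}} := conj_aut P @* 'N_S(P).

Definition Nphi P Q (f : gT -> gT) : {set gT} :=
  [set g in 'N_S(P) |
     [exists a in AutS Q, [forall x in P, f (x ^ g^-1) == a (f x)]]].

(* Nphi P Q f is a subgroup whenever f is an F-isomorphism, see gen_Nphi;
   <<_>> only supplies the group structure. *)
Definition saturated (p : nat) F : Prop :=
  (forall P, P \subset S -> fully_normalized F P ->
     fully_centralized F P /\ p.-Sylow(AutF F P) (AutS P)) /\
  (forall P Q f, is_fiso F P Q f -> fully_centralized F Q ->
     exists2 g, fs_hom F <<Nphi P Q f>>%G S g & {in P, f =1 g}).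

(* Q <*> P is the product QP: the case Q = R = S, f = c_g forces P <| S. *)
Definition fnormal F P : Prop :=
  P \subset S /\
  forall Q R f, fs_hom F Q R f ->
    exists g, [/\ fs_hom F (Q <*> P)%G (R <*> P)%G g,
                  {in Q, f =1 g} & g @: P = P].

Lemma gen_Nphi F P Q f : is_fiso F P Q f -> <<Nphi P Q f>> = Nphi P Q f.
Proof.
case=> homf _; have [_ _ fQ] := fs_inj homf.
have gN : group_set (Nphi P Q f).
  apply/group_setP; split=> [|g h].
    rewrite inE group1 /=; apply/existsP; exists 1.
    rewrite (group1 (conj_aut Q @* 'N_S(Q))%G) /=.
    by apply/forall_inP=> x _; rewrite invg1 conjg1 perm1.
  rewrite inE => /andP[Ng /exists_inP[a Sa /forall_inP fa]].
  rewrite inE => /andP[Nh /exists_inP[b Sb /forall_inP fb]].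
  rewrite inE groupM //=; apply/exists_inP; exists (b * a).
    exact: (groupM (G := (conj_aut Q @* 'N_S(Q))%G)).
  apply/forall_inP=> x Px; rewrite invMg conjgM permM.
  have Phx : x ^ h^-1 \in P.
    by rewrite memJ_norm // groupV; case/setIP: Nh.
  by rewrite (eqP (fa _ Phx)) (eqP (fb _ Px)).
by rewrite -[RHS]/(gval (Group gN)) -[LHS]/(<<Group gN>>) genGid.
Qed.

End FusionSystems.

(* The finite p-group T lives in its own ambient group type, and the inclusion
   of A in T is an injective homomorphism i; Aut_isom transports an
   automorphism of A along i to one of i @* A. *)
Definition fusion_realizable (p : nat) (gT : finGroupType) (A : {group gT})
    (Gamma : {group {perm gT}}) : Prop :=
  exists (hT : finGroupType) (T : {group hT}) (i : {morphism A >-> hT})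
         (inji : 'injm i) (F : fusion_system T),
    let B := (i @* A)%G in
    [/\ p.-group T /\ saturated p F,
        B \subset T,
        'C_T(B) = B,
        ~ fnormal F B
      & AutF F B = Aut_isom inji (subxx A) @: Gamma].

(* Main.v *)
Require Import Defs.
From HB Require Import structures.
From mathcomp Require Import all_boot all_fingroup all_solvable.
From mathcomp Require Import ssralg zmodp ring.
From Stdlib Require Import Classical.

(* A strongly closed abelian subgroup A is normal in a saturated system: by
   downward induction on |P| every morphism on P extends over P A. After transport
   to a fully normalized Q, an automorphism of Q extends to a subgroup containing
   N_A(Q), because the automorphisms of Q stabilizing Q >= Q :&: A >= 1 form a
   normal p-subgroup of Aut_F(Q), hence lie in Aut_S(Q).

   To see that A is strongly closed, suppose that R is not contained in A, that g
   carries R into A and N_S(R) into S, and that R0 = R :&: A is as large as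
   possible, so that R = R0 <x> with x acting on A as an involution. By
   maximality only R0 is carried into A from N_A(R), so N_A(R) / R0 embeds in
   S / A = D_8. But N_A(R) contains the large group C_A(x) and more: its image in
   D_8 is a four-group, which fixes an element of order 2^n of g(R0) <= A. This is
   absurd, since a four-group of D_8 has norm 0 on A, so that its fixed points
   have exponent 4.

   Only the action of S on A matters here, not the extension class. If B is a
   copy of A in T as in the definition of realizability, then N_T(B) acts on B
   like a subgroup of D_8 by Sylow's theorem in Gamma; the same computation shows
   that B is the only subgroup of N_T(B) isomorphic to B, so B is normal in T and
   the argument above applies to T. *)

Set Implicit Arguments.
Unset Strict Implicit.
Unset Printing Implicit Defensive.

Import GRing.Theory.
Local Open Scope group_scope.

(** * Morphisms of fusion systems *)

Section Morphisms.

Variables (gT : finGroupType) (S : {group gT}) (F : fusion_system S).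
Implicit Types (P Q R : {group gT}) (f g : gT -> gT).

Lemma hom_incl P Q : P \subset Q -> Q \subset S -> F P Q id.
Proof.
move=> PQ QS; apply: (@fs_ext _ _ F _ _ (fun x => x ^ 1^-1)) => [x _|].
  by rewrite invg1 conjg1.
by apply: fs_conj; rewrite ?group1 ?(subset_trans PQ) // invg1 conjsg1.
Qed.

Lemma hom_group P Q f : F P Q f -> exists R : {group gT}, f @: P = R.
Proof.
case/fs_inj=> fM _ _; exists (Morphism fM @* P)%G.
by rewrite /= morphimEdom.
Qed.

Lemma fiso_im P Q f : is_fiso F P Q f -> f @: P = Q.
Proof.
case=> /fs_inj[_ _ fQ] [g [/fs_inj[_ _ gP] _ gK]].
apply/setP=> y; apply/imsetP/idP=> [[x Px ->]|Qy]; first exact: fQ.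
by exists (g y); rewrite ?gP ?gK.
Qed.

Lemma hom_card P Q f : F P Q f -> #|f @: P| = #|P|.
Proof. by case/fs_inj=> _ inj_f _; rewrite card_in_imset. Qed.

Lemma fiso_card P Q f : is_fiso F P Q f -> #|Q| = #|P|.
Proof. by move=> isof; rewrite -(fiso_im isof) (hom_card (proj1 isof)). Qed.

Lemma fiso_sub P Q f : is_fiso F P Q f -> P \subset S /\ Q \subset S.
Proof. by case=> /fs_obj. Qed.

Lemma hom_widen P Q f : F P Q f -> F P S f.
Proof.
by move=> homf; have [_ QS] := fs_obj homf; apply: fs_comp homf (hom_incl QS _).
Qed.

Lemma hom_restr P Q P1 Q1 f : F P Q f -> P1 \subset P ->
  f @: P1 \subset Q1 -> Q1 \subset S -> F P1 Q1 f.
Proof.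
move=> homf P1P fQ1 Q1S; have [PS QS] := fs_obj homf.
have hom1 : F P1 Q f := fs_comp (hom_incl P1P PS) homf.
(* Factoring through the image is what allows the codomain to shrink from [Q] to [Q1]. *)
have [R _ isof] := fs_factor hom1.
apply: fs_comp (proj1 isof) (hom_incl _ Q1S).
by rewrite -(fiso_im isof).
Qed.

Lemma hom_fiso P Q R f : F P Q f -> f @: P = R -> is_fiso F P R f.
Proof.
case/fs_factor=> R1 _ isof fR; suffices -> : R = R1 by [].
by apply: val_inj; rewrite /= -fR (fiso_im isof).
Qed.

Lemma fiso_inv P Q f : is_fiso F P Q f ->
  exists g, [/\ is_fiso F Q P g, {in P, cancel f g} & {in Q, cancel g f}].
Proof.
by case=> homf [g [homg fK gK]]; exists g; split=> //; split; last exists f.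
Qed.

Lemma fiso_comp P Q R f g :
  is_fiso F P Q f -> is_fiso F Q R g -> is_fiso F P R (g \o f).
Proof.
move=> isof isog; have homgf := fs_comp (proj1 isof) (proj1 isog).
by apply: hom_fiso homgf _; rewrite imset_comp (fiso_im isof) (fiso_im isog).
Qed.

Lemma hom_mem P Q f x : F P Q f -> x \in P -> f x \in Q.
Proof. by case/fs_inj=> _ _ fQ /fQ. Qed.

Lemma hom_M P Q f : F P Q f -> {in P &, {morph f : x y / x * y}}.
Proof. by case/fs_inj. Qed.

Lemma hom_inj P Q f : F P Q f -> {in P &, injective f}.
Proof. by case/fs_inj. Qed.

Lemma hom_1 P Q f : F P Q f -> f 1 = 1.
Proof. by case/fs_inj=> fM _ _; have := morph1 (Morphism fM). Qed.

Lemma hom_X P Q f n : F P Q f -> {in P, {morph f : x / x ^+ n}}.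
Proof.
case/fs_inj=> fM _ _ x Px; exact: (morphX (Morphism fM)).
Qed.

Lemma hom_V P Q f : F P Q f -> {in P, {morph f : x / x^-1}}.
Proof.
case/fs_inj=> fM _ _ x Px; exact: (morphV (Morphism fM)).
Qed.

Lemma hom_J P Q f : F P Q f -> {in P &, {morph f : x y / x ^ y}}.
Proof.
case/fs_inj=> fM _ _ x y Px Py; exact: (morphJ (Morphism fM)).
Qed.

Lemma hom_gen P Q f (A : {set gT}) (R : {group gT}) : F P Q f ->
  A \subset P -> f @: A \subset R -> f @: <<A>> \subset R.
Proof.
move=> homf AP fAR; have [fM _ _] := fs_inj homf.
have := morphim_gen (Morphism fM) AP.
rewrite morphimEsub ?gen_subG //= => ->.
by rewrite gen_subG morphimEsub.
Qed.

(** Passing to a conjugate with a larger normalizer must stop, since [#|S|] bounds the orders. The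
    case split is classical because [fully_normalized] is a proposition quantifying over all
    morphisms. *)
Lemma ex_fully_normalized P : P \subset S ->
  exists2 Q, fully_normalized F Q & fconj F P Q.
Proof.
have [m] := ubnP (#|S| - #|'N_S(P)|); elim: m P => // m IHm P ltm PS.
have [fnP|] := classic (fully_normalized F P).
  exists P => //; exists id; apply: hom_fiso (hom_incl (subxx _) PS) _.
  exact: imset_id.
move=> /not_all_ex_not[Q nfnP].
have [[f isof] /negP] := imply_to_and _ _ nfnP; rewrite -ltnNge => ltPQ.
have [_ QS] := fiso_sub isof.
have leS : #|'N_S(Q)| <= #|S| by rewrite subset_leq_card ?subsetIl.
have [|//|R fnR [g isog]] := IHm Q.
  rewrite -ltnS; apply: leq_trans ltm.
  by rewrite ltnS ltn_sub2l // (leq_trans ltPQ).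
by exists R => //; exists (g \o f); apply: fiso_comp isof isog.
Qed.

Lemma AutFE P a : (a \in AutF F P) = (a \in Aut P) && F P P a.
Proof. by rewrite in_set. Qed.

Lemma AutF_group_set P : P \subset S -> group_set (AutF F P).
Proof.
move=> PS; apply/group_setP; split=> [|a b]; rewrite !AutFE.
  rewrite group1 /=; apply: fs_ext (hom_incl (subxx _) PS).
  by move=> x _; rewrite perm1.
case/andP=> Aa homa /andP[Ab homb]; rewrite groupM //=.
apply: (@fs_ext _ _ F _ _ (b \o a)) (fs_comp homa homb).
by move=> x _; rewrite permM.
Qed.

(** A morphism is determined only on [P], while members of [Aut P] are permutations fixing
    everything outside [P]; [aut] picks that representative. *)
Lemma fiso_AutF P f : is_fiso F P P f ->
  exists2 a, a \in AutF F P & {in P, f =1 a}.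
Proof.
case=> homf _; have [fM inj_f fP] := fs_inj homf.
have fPsub : f @: P \subset P by apply/subsetP=> _ /imsetP[x Px ->]; apply: fP.
have injf : 'injm (Morphism fM) by apply/injmP.
have fPP : Morphism fM @* P = P.
  by apply/eqP; rewrite eqEcard card_injm // leqnn andbT /= morphimEdom.
exists (aut injf fPP); last by move=> x Px; rewrite autE.
rewrite AutFE Aut_aut; apply: fs_ext homf => x Px; by rewrite autE.
Qed.

Lemma AutF_fiso P a : a \in AutF F P -> is_fiso F P P a.
Proof.
rewrite AutFE => /andP[Aa homa]; apply: hom_fiso homa _.
by rewrite -[RHS](im_autm Aa) morphimEdom; apply: eq_imset => x; rewrite /= autmE.
Qed.

Lemma AutS_AutF P : P \subset S -> AutS S P \subset AutF F P.
Proof.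
move=> PS; apply/subsetP=> _ /morphimP[g Ng /setIP[Sg _] ->].
rewrite AutFE Aut_aut /=.
have Ngi : g^-1 \in 'N(P) by rewrite groupV.
apply: (@fs_ext _ _ F _ _ (fun x => x ^ (g^-1)^-1)).
  by move=> x Px; rewrite norm_conj_autE // invgK.
by apply: fs_conj; rewrite ?groupV // invgK (normP Ng).
Qed.

End Morphisms.

(** * Extension of morphisms in saturated systems *)

Section Saturation.

Variables (gT : finGroupType) (S : {group gT}) (F : fusion_system S) (p : nat).
Hypotheses (pS : p.-group S) (satF : saturated p F).
Implicit Types (P Q R : {group gT}) (f g : gT -> gT).

Lemma sat_ext P Q (H : {group gT}) f : is_fiso F P Q f -> fully_centralized F Q ->
  H \subset Nphi S P Q f -> exists2 g, F H S g & {in P, f =1 g}.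
Proof.
move=> isof fcQ sHN; have [_ /(_ P Q f isof fcQ) [g homg eqfg]] := satF.
exists g => //; apply: (hom_restr homg) (subxx _).
  exact: subset_trans sHN (subset_gen _).
apply/subsetP=> _ /imsetP[x Hx ->]; apply: (hom_mem homg).
by apply: mem_gen; apply: (subsetP sHN).
Qed.

(** An isomorphism [f] carries Aut_S(P) to a p-subgroup [X] of Aut_F(Q). By Sylow some [b] in
    Aut_F(Q) conjugates [X] into Aut_S(Q), and then N_φ for φ = [b \o f] is all of N_S(P). *)
Lemma ext_normalizer P Q : fully_normalized F Q -> fconj F P Q ->
  exists2 g, F ('N_S(P))%G S g & g @: P = Q.
Proof.
move=> fnQ [f isof]; have [PS QS] := fiso_sub isof.
have [fcQ sylQ] := (proj1 satF) Q QS fnQ.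
have [fM inj_f fQ] := fs_inj (proj1 isof).
have injf : 'injm (Morphism fM) by apply/injmP.
have fP : Morphism fM @* P = Q by rewrite morphimEdom (fiso_im isof).
pose X := (Aut_isom injf (subxx P) @* (AutS S P))%G.
have XF : X \subset Group (AutF_group_set F QS).
  apply/subsetP=> _ /morphimP[a Aa Sa ->] /=; rewrite AutFE.
  rewrite -[in X in X && _]fP Aut_Aut_isom /=.
  have [h [isoh fK hK]] := fiso_inv isof.
  have homa : F P P a.
    by have := subsetP (AutS_AutF F PS) _ Sa; rewrite AutFE; case/andP.
  apply: fs_ext (fs_comp (proj1 isoh) (fs_comp homa (proj1 isof))) => y Qy /=.
  have hP : h y \in P by apply: hom_mem (proj1 isoh) Qy.
  have := Aut_isomE injf (subxx P) Aa hP; rewrite /= hK // => ->.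
have pX : p.-group X.
  by apply: morphim_pgroup; apply: morphim_pgroup; apply: pgroupS pS; apply: subsetIl.
pose AutFQ := Group (AutF_group_set F QS).
have sylAQ : p.-Sylow(AutFQ) (conj_aut Q @* 'N_S(Q))%G := sylQ.
have [b bF sXb] := Sylow_Jsub sylAQ XF pX.
have isob := fiso_comp isof (AutF_fiso bF).
have [|g homg eqg] := sat_ext (H := 'N_S(P)%G) isob fcQ.
  apply/subsetP=> g /= NSg; rewrite inE NSg /=; have [Sg Ng] := setIP NSg.
  have Vg : g^-1 \in 'N(P) by rewrite groupV.
  have aA : conj_aut P g^-1 \in Aut P by rewrite Aut_aut.
  pose a := Aut_isom injf (subxx P) (conj_aut P g^-1).
  apply/exists_inP; exists (a ^ b).
    apply: (subsetP sXb); rewrite memJ_conjg; apply: mem_morphim => //.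
    by apply: mem_morphim; rewrite // groupV.
  apply/forall_inP=> x Px; rewrite /= conjgE !permM permK.
  by have := Aut_isomE injf (subxx P) aA Px; rewrite /= -/a => ->; rewrite norm_conj_autE.
exists g => //; rewrite -(fiso_im isob); apply/esym/eq_in_imset.
exact: eqg.
Qed.

End Saturation.

(** * Strongly closed abelian subgroups *)

Definition strongly_closed (gT : finGroupType) (S : {group gT})
    (F : fusion_system S) (A : {set gT}) : Prop :=
  forall P f x, fs_hom F P S f -> x \in P -> x \in A -> f x \in A.

Section StronglyClosedAbelian.

Variables (gT : finGroupType) (S : {group gT}) (F : fusion_system S) (p : nat).
Variable A : {group gT}.
Hypotheses (pS : p.-group S) (satF : saturated p F).
Hypotheses (nAS : A <| S) (cAA : abelian A) (scA : strongly_closed F A).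
Implicit Types (P Q R : {group gT}) (f g : gT -> gT).

Let AS : A \subset S := normal_sub nAS.

Lemma strongly_closed_im P f : F P S f -> A \subset P -> f @: A = A.
Proof.
move=> homf AP; apply/eqP; rewrite eqEcard; apply/andP; split.
  by apply/subsetP=> _ /imsetP[x Ax ->]; apply: (scA homf _ Ax); apply: (subsetP AP).
by rewrite card_in_imset //; apply: sub_in2 (hom_inj homf) => x /(subsetP AP).
Qed.

Definition extends P f :=
  exists g, [/\ F (P <*> A)%G S g, {in P, f =1 g} & g @: A = A].

Lemma extends_over P f : F P S f -> A \subset P -> extends P f.
Proof.
move=> homf AP; exists f; split=> //; last exact: strongly_closed_im homf AP.
suffices -> : (P <*> A)%G = P by [].
by apply: val_inj; apply/joing_idPl.
Qed.

Lemma join_im P (Q : {group gT}) g : F (P <*> A)%G S g -> g @: P = Q ->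
  g @: A = A -> is_fiso F (P <*> A)%G (Q <*> A)%G g.
Proof.
move=> homg gP gA; apply: (hom_fiso homg); have [gM _ _] := fs_inj homg.
have sPA : P :|: A \subset P <*> A by apply: subset_gen.
have := morphim_gen (Morphism gM) sPA.
by rewrite morphimEdom morphimEsub //= imsetU gP gA.
Qed.

(** Normalizers grow in the p-group QA; the part in [Q] of a new normalizing element can be
    cancelled, leaving an element of [A]. *)
Lemma ex_normalizing Q : Q \subset S -> ~~ (A \subset Q) ->
  exists2 a, a \in 'N_A(Q) & a \notin Q.
Proof.
move=> QS nAQ; have nQA : Q \subset 'N(A).
  exact: subset_trans QS (normal_norm nAS).
have pQA : p.-group (Q <*> A) by apply: pgroupS pS; rewrite join_subG QS AS.
have ltQ : Q \proper Q <*> A by rewrite properE joing_subl join_subG subxx.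
have /properP[_ [x]] := nilpotent_proper_norm (pgroup_nil pQA) ltQ.
case/setIP; rewrite /= norm_joinEl // => /mulsgP[q a Qq Aa ->] NQ nQ.
have Nq : q \in 'N(Q) by apply: (subsetP (normG Q)).
exists a; first by rewrite inE Aa -(groupMl _ Nq).
by rewrite groupMl in nQ.
Qed.

(** This puts N_A(Q) inside N_φ for every automorphism φ of [Q]. Elements of N_A(Q) induce members
    of a normal p-subgroup [K] of Aut_F(Q); such a subgroup lies in O_p, hence in the Sylow subgroup
    Aut_S(Q). *)
Lemma AutF_stable_sub Q (a : {perm gT}) : Q \subset S -> fully_normalized F Q ->
  a \in AutF F Q -> {in 'N_A(Q), forall u, conj_aut Q u ^ a \in AutS S Q}.
Proof.
move=> QS fnQ AFa u /setIP[Au Nu].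
pose AutFQ := Group (AutF_group_set F QS).
have AFP b x : b \in AutF F Q -> x \in Q -> b x \in Q.
  by rewrite AutFE => /andP[_ homb]; apply: hom_mem homb.
have AFA b x : b \in AutF F Q -> x \in Q -> x \in A -> b x \in A.
  rewrite AutFE => /andP[_ homb] Qx.
  by apply: (scA _ Qx); apply: hom_widen homb.
have AFM b : b \in AutF F Q -> {in Q &, {morph b : x y / x * y}}.
  by rewrite AutFE => /andP[_ homb]; apply: hom_M homb.
have AFV b : b \in AutF F Q -> {in Q, {morph b : x / x^-1}}.
  by rewrite AutFE => /andP[_ homb]; apply: hom_V homb.
(* [K] is the stabilizer of the chain Q >= Q :&: A >= 1: trivial on Q :&: A and on the quotient.
   Strong closure of [A] makes it normal in Aut_F(Q). *)
pose K := [set b in AutF F Q |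
  [forall x in Q, ((x \in A) ==> (b x == x)) && (x^-1 * b x \in A)]].
have KP b : reflect (b \in AutF F Q /\ {in Q, forall x,
    (x \in A -> b x = x) /\ x^-1 * b x \in A}) (b \in K).
  rewrite [b \in K]in_set; apply: (iffP andP) => [[-> /forall_inP Kb]|[-> Kb]]; split=> //.
    by move=> x /Kb /andP[/implyP bx ->]; split=> // /bx /eqP.
  by apply/forall_inP=> x /Kb[bx ->]; rewrite andbT; apply/implyP=> /bx ->.
have gK : group_set K.
  apply/group_setP; split=> [|b c /KP[Fb Kb] /KP[Fc Kc]].
    by apply/KP; split=> [|x Qx]; rewrite ?(group1 AutFQ) // perm1 mulVg group1.
  apply/KP; split=> [|x Qx]; first exact: (groupM (G := AutFQ)).
  have [bA bQ] := Kb x Qx; have [cA cQ] := Kc (b x) (AFP _ _ Fb Qx).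
  rewrite permM; split=> [Ax|]; first by rewrite cA bA.
  by rewrite -(mulKVg (b x) (c (b x))) mulgA groupM.
pose KG := Group gK.
have nK : KG <| AutFQ.
  apply/andP; split; first by apply/subsetP=> b /KP[].
  apply/normsP=> c Fc; apply/setP=> b; rewrite mem_conjg.
  have conjK (d : {perm gT}) : d \in AutF F Q -> {in K, forall b, b ^ d \in K}.
    move=> Fd {}b /KP[Fb Kb]; apply/KP; split=> [|x Qx].
      exact: (groupJ (G := AutFQ)).
    have Fdi : d^-1 \in AutF F Q by apply: (groupVr (G := AutFQ)).
    have Qd := AFP _ _ Fdi Qx; have [bA bQ] := Kb _ Qd.
    rewrite conjgE !permM; split=> [Ax|].
      by rewrite bA ?permKV //; apply: AFA.
    have Qb := AFP _ _ Fb Qd.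
    have := AFA d _ Fd (groupM (groupVr Qd) Qb) bQ.
    by rewrite AFM ?groupV // AFV // permKV.
  apply/idP/idP => [Kb|]; last by apply: conjK; apply: (groupVr (G := AutFQ)).
  by rewrite -(conjgKV c b); apply: conjK.
have pK : p.-group KG.
  apply/pgroupP=> q q_pr /(Cauchy q_pr)[b /KP[Fb Kb] ob].
  (* The displacement [x^-1 * b x] lies in Q :&: A and is fixed by [b], so displacements accumulate
     as powers. Hence [b ^+ #|A| = 1] and the order of [b] is a power of p. *)
  have bX m x : x \in Q -> (b ^+ m) x = x * (x^-1 * b x) ^+ m.
    move=> Qx; elim: m => [|m IHm]; first by rewrite perm1 mulg1.
    have [_ bxA] := Kb x Qx.
    have Qd : x^-1 * b x \in Q by rewrite groupM ?groupV ?AFP.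
    rewrite expgSr permM IHm AFM ?groupX //.
    rewrite (proj1 (Kb _ (groupX m Qd)) (groupX m bxA)).
    by rewrite expgS !mulgA mulgV mul1g.
  have : b ^+ #|A| = 1.
    apply: (eq_Aut (A := Q)) => [||x Qx]; rewrite ?group1 //.
      by apply: groupX; move: Fb; rewrite AutFE => /andP[].
    by rewrite bX // perm1 expg_cardG ?mulg1 //; have [] := Kb x Qx.
  move/eqP; rewrite -order_dvdn ob => qA.
  by have := pgroupS AS pS; move/pgroupP; apply.
have [_ sylQ] := (proj1 satF) Q QS fnQ.
have sK : K \subset AutS S Q.
  apply: subset_trans (pcore_max pK nK) _.
  exact: (pcore_sub_Hall (sylQ : p.-Sylow(AutFQ) (conj_aut Q @* 'N_S(Q))%G)).
apply: (subsetP sK); rewrite memJ_norm; last first.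
  by apply: (subsetP (normal_norm nK)).
have Su := subsetP AS _ Au.
apply/KP; split=> [|x Qx].
  by apply: (subsetP (AutS_AutF F QS)); apply: mem_morphim; rewrite // inE Su.
rewrite norm_conj_autE //; split=> [Ax|].
  by apply/conjg_fixP/commgP/(centsP cAA).
have -> : x^-1 * x ^ u = (u^-1) ^ x * u by rewrite !conjgE !mulgA.
rewrite groupM // memJ_norm ?groupV //.
exact: subsetP (normal_norm nAS) _ (subsetP QS _ Qx).
Qed.

(** Saturation extends [f] to N_φ, which contains [Q] and N_A(Q). Unless [A] already lies in [Q]
    this is strictly larger than [Q], so the induction hypothesis takes over. *)
Lemma extends_AutF Q f :
    (forall (H : {group gT}) g, #|Q| < #|H| -> F H S g -> extends H g) ->
  fully_normalized F Q -> is_fiso F Q Q f -> extends Q f.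
Proof.
move=> IH fnQ isof; have [QS _] := fiso_sub isof.
have homf : F Q S f := hom_widen (proj1 isof).
have [AQ|nAQ] := boolP (A \subset Q); first exact: extends_over.
have [a AFa eqfa] := fiso_AutF isof.
have [fcQ _] := (proj1 satF) Q QS fnQ.
pose H := <<Nphi S Q Q f>>%G.
have [|h homh eqfh] := sat_ext satF (H := H) isof fcQ.
  by rewrite /= (gen_Nphi isof).
have QH : Q \subset H.
  apply/subsetP=> g Qg; apply: mem_gen; rewrite inE.
  rewrite inE (subsetP QS) //= (subsetP (normG Q)) //=.
  have Qfg : (f g)^-1 \in Q by rewrite groupV (hom_mem (proj1 isof)).
  apply/exists_inP; exists (conj_aut Q (f g)^-1).
    apply: mem_morphim; first exact: (subsetP (normG Q)).
    by rewrite inE (subsetP QS) //= (subsetP (normG Q)).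
  apply/forall_inP=> x Qx; rewrite conj_autE ?(hom_mem (proj1 isof)) //.
  by rewrite (hom_J (proj1 isof)) ?groupV // (hom_V (proj1 isof)).
have NH : 'N_A(Q) \subset H.
  apply/subsetP=> g NAg; have [Ag Ng] := setIP NAg.
  have Sg := subsetP AS _ Ag; apply: mem_gen; rewrite inE inE Sg Ng /=.
  apply/exists_inP; exists (conj_aut Q g^-1 ^ a).
    by apply: AutF_stable_sub => //; rewrite groupV.
  apply/forall_inP=> x Qx.
  have Qx' : x ^ g^-1 \in Q by rewrite memJ_norm ?groupV.
  rewrite !eqfa // conjgE !permM permK norm_conj_autE ?groupV //.
have [|k [homk eqhk kA]] := IH H h _ homh.
  have [b Nb nQb] := ex_normalizing QS nAQ.
  by apply/proper_card/properP; split=> //; exists b => //; apply: (subsetP NH).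
exists k; split=> // [|x Qx].
  apply: (hom_restr homk) (subxx _); first by apply: genS (setSU _ QH).
  apply/subsetP=> _ /imsetP[x Qx ->]; apply: (hom_mem homk).
  by move: x Qx; apply/subsetP; apply: genS (setSU _ QH).
by rewrite eqfh // eqhk // (subsetP QH).
Qed.

(** Some [g] on N_S(P) also maps [P] onto [Q], and by induction it extends to [G] over [A]. Then [f]
    differs from [G] by an automorphism of [Q], which the preceding lemma extends. *)
Lemma extends_fully_normalized P Q f :
    (forall (H : {group gT}) g, #|P| < #|H| -> F H S g -> extends H g) ->
  fully_normalized F Q -> is_fiso F P Q f -> extends P f.
Proof.
move=> IH fnQ isof; have [PS QS] := fiso_sub isof.
have homf : F P S f := hom_widen (proj1 isof).
have [AP|nAP] := boolP (A \subset P); first exact: extends_over.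
have fcPQ : fconj F P Q by exists f.
have [g homg gP] := ext_normalizer pS satF fnQ fcPQ.
have ltPS : P \proper S.
  by rewrite properE PS; apply: contra nAP => /(subset_trans AS).
have ltPN := nilpotent_proper_norm (pgroup_nil pS) ltPS.
have [G [homG eqgG GA]] := IH _ _ (proper_card ltPN) homg.
have PN := proper_sub ltPN.
have GP : G @: P = Q.
  by rewrite -gP; apply/esym/eq_in_imset => x Px; apply: eqgG; apply: (subsetP PN).
have sub : P <*> A \subset 'N_S(P) <*> A by apply: genS (setSU _ PN).
have homG1 : F (P <*> A)%G S G.
  apply: (hom_restr homG) (subxx _) => //; apply/subsetP=> _ /imsetP[x Qx ->].
  by apply: (hom_mem homG); apply: (subsetP sub).
have isoG := join_im homG1 GP GA.
have [k [isok Gk kG]] := fiso_inv isoG.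
have homk : F Q P k.
  apply: (hom_restr (proj1 isok)) PS; first exact: joing_subl.
  apply/subsetP=> _ /imsetP[x Qx ->]; move: Qx; rewrite -GP => /imsetP[y Py ->].
  by rewrite Gk // mem_gen // inE Py.
have [|||h [homh eqfh hA]] := @extends_AutF Q (f \o k).
- by move=> H h; rewrite (fiso_card isof); apply: IH.
- exact: fnQ.
- apply: hom_fiso (fs_comp homk (proj1 isof)) _; apply/eqP; rewrite eqEcard.
  rewrite (hom_card (fs_comp homk (proj1 isof))) leqnn andbT.
  apply/subsetP=> _ /imsetP[x Qx ->].
  exact: hom_mem (fs_comp homk (proj1 isof)) Qx.
exists (h \o G); split; first exact: fs_comp (proj1 isoG) homh.
  move=> x Px; have Qx : G x \in Q by rewrite -GP imset_f.
  by rewrite /= -eqfh //= Gk // mem_gen // inE Px.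
by rewrite imset_comp GA.
Qed.

(** With [h] an isomorphism from the image of [f] to a fully normalized [Q], both [h \o f] and [h]
    extend over [A]; composing the first extension with the inverse of the second extends [f]. *)
Lemma extends_hom P f : F P S f -> extends P f.
Proof.
have [m] := ubnP (#|S| - #|P|); elim: m P f => // m IHm P f ltm homf.
have [PS _] := fs_obj homf.
have IH (H : {group gT}) g : #|P| < #|H| -> F H S g -> extends H g.
  move=> ltPH homg; apply: (IHm _ _ _ homg); rewrite -ltnS; apply: leq_trans ltm.
  rewrite ltnS ltn_sub2l // (leq_trans ltPH) // subset_leq_card //.
  by case/fs_obj: homg.
have [R fP] := hom_group homf; have isof := hom_fiso homf fP.
have [_ RS] := fiso_sub isof.
have [Q fnQ [h isoh]] := ex_fully_normalized F RS.
have [g [homg eqg gA]] := extends_fully_normalized IH fnQ (fiso_comp isof isoh).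
have [|k [homk eqk kA]] := extends_fully_normalized _ fnQ isoh.
  by move=> H k; rewrite (fiso_card isof); apply: IH.
have gP : g @: P = Q.
  by rewrite -(fiso_im (fiso_comp isof isoh)); apply/esym/eq_in_imset.
have kR : k @: R = Q by rewrite -(fiso_im isoh); apply/esym/eq_in_imset.
have isog := join_im homg gP gA; have isok := join_im homk kR kA.
have [l [isol kl lk]] := fiso_inv isok.
exists (l \o g); split.
- apply: fs_comp (proj1 isog) (hom_widen (proj1 isol)).
- move=> x Px; have Rx : f x \in R by rewrite -fP imset_f.
  by rewrite /= -eqg //= eqk // kl // mem_gen // inE Rx.
rewrite imset_comp gA -[in RHS](imset_id A) -{1}kA -imset_comp.
by apply: eq_in_imset => x Ax /=; rewrite kl // mem_gen // inE Ax orbT.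
Qed.

Theorem strongly_closed_fnormal : fnormal F A.
Proof.
split=> // Q R f homf; have [QS RS] := fs_obj homf.
have [g [homg eqfg gA]] := extends_hom (hom_widen homf).
exists g; split=> //; apply: (hom_restr homg) => //; last first.
  by rewrite join_subG RS AS.
apply: (hom_gen homg); first exact: subset_gen.
rewrite imsetU gA; apply: subset_trans (subset_gen _); apply: setSU.
apply/subsetP=> _ /imsetP[x Qx ->]; rewrite -eqfg //; exact: hom_mem homf Qx.
Qed.

End StronglyClosedAbelian.

(** * A criterion for strong closure *)

(* In the application x acts on B = C_{2^n}^3 as Z[C_2] + Z_- modulo 2^n: with
   w0, w0 ^ x, w1 a basis such that w1 ^ x = w1^-1, take c = w0 * w0 ^ x,
   u = w0 ^+ 2^(n-1) and h = w1 ^+ 2^(n-2).  The condition c ^+ 4 != 1 and the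
   membership of [~ u, x] = c ^+ 2^(n-1) in <[c ^+ 4]> are where n >= 3 enters. *)
Definition involution_witness (gT : finGroupType) (B : {group gT})
    (x c u h : gT) : Prop :=
  [/\ [/\ c \in B, u \in B & h \in B],
      c ^ x = c /\ c ^+ 4 != 1,
      [/\ u ^+ 2 = 1, [~ u, x] != 1 & [~ u, x] \in <[c ^+ 4]>],
      h ^+ 4 = 1 /\ [~ h, x] = h ^+ 2
    & h ^+ 2 != 1 /\ [~ u, x] != h ^+ 2].

(** These conditions collect what the fusion argument uses about T acting on B. The last one says
    that a four-group of T/B, generated by [y1] and [y2], is self-centralizing and that its fixed
    points in [B] have exponent dividing 4. *)
Definition rigid (gT : finGroupType) (T B : {group gT}) : Prop :=
  [/\ {in T, forall y, y ^+ 4 \in B},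
      {in B, forall a, a ^+ 2 = 1 -> exists2 b, b \in B & a = b ^+ 4},
      {in T, forall x, x \notin B -> x ^+ 2 \in B -> exists c u h,
        involution_witness B x c u h}
    & {in T & &, forall y1 y2 y3,
        [~ y1, y2] \in B -> [~ y1, y3] \in B -> [~ y2, y3] \in B ->
        y1 ^+ 2 \in B -> y2 ^+ 2 \in B ->
        y1 \notin B -> y2 \notin B -> y1 * y2 \notin B ->
        [|| y3 \in B, y3 * y1 \in B, y3 * y2 \in B | y3 * (y1 * y2) \in B] /\
        {in B, forall a, a ^ y1 = a -> a ^ y2 = a -> a ^+ 4 = 1}}].

(** Elements of order 2 in [B] are fourth powers, and fourth powers in [T] lie in [B], so [f]
    permutes Ω_1(B). If [f @: B] were not [B], some [f b] would be an involution modulo [B]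
    centralizing f(Ω_1(B)) = Ω_1(B), but its witness [u] is an element of Ω_1(B) that it moves. *)
Lemma rigid_im (gT : finGroupType) (T B : {group gT}) (f : gT -> gT) :
    abelian B -> rigid T B -> {in B &, {morph f : x y / x * y}} ->
    {in B &, injective f} -> f @: B \subset T ->
  f @: B = B.
Proof.
move=> cBB [T4 Bsqr Tinv _] fM inj_f fBT; pose phi := Morphism fM.
apply/eqP; rewrite eqEcard card_in_imset // leqnn andbT.
apply/negPn/negP => /subsetPn[_ /imsetP[a Ba ->] nBfa].
have [b Bb [nBfb Bfb2]] : exists2 b, b \in B & f b \notin B /\ f b ^+ 2 \in B.
  have Tfa : f a \in T by apply: (subsetP fBT); apply: imset_f.
  have [fa2|nfa2] := boolP (f a ^+ 2 \in B); first by exists a.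
  exists (a ^+ 2); first exact: groupX.
  have -> : f (a ^+ 2) = f a ^+ 2 := morphX phi _ Ba.
  by rewrite -expgM; split; last exact: T4.
have Tfb : f b \in T by apply: (subsetP fBT); apply: imset_f.
have [c [u [h [[_ Bu _] _ [u2 ufb _] _ _]]]] := Tinv _ Tfb nBfb Bfb2.
pose W := [set w in B | w ^+ 2 == 1].
have fW : f @: W = W.
  apply/eqP; rewrite eqEcard card_in_imset ?leqnn ?andbT; last first.
    by apply: sub_in2 inj_f => w; rewrite inE => /andP[].
  apply/subsetP=> _ /imsetP[w Ww ->]; move: Ww; rewrite !inE.
  case/andP=> Bw /eqP w2; have [d Bd dw] := Bsqr w Bw w2.
  have -> : f w ^+ 2 = f (w ^+ 2) := esym (morphX phi 2 Bw).
  have f1 : f 1 = 1 := morph1 phi.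
  rewrite w2 f1 eqxx andbT dw.
  have -> : f (d ^+ 4) = f d ^+ 4 := morphX phi _ Bd.
  by apply: T4; apply: (subsetP fBT); apply: imset_f.
have : u \in f @: W by rewrite fW inE Bu u2 eqxx.
case/imsetP=> w; rewrite inE => /andP[Bw _] uw.
case/negP: ufb; apply/commgP; rewrite uw; have cbw := centsP cBB _ Bw _ Bb.
by rewrite /commute -!fM // cbw.
Qed.

Section StronglyClosed.

Variables (gT : finGroupType) (T B : {group gT}) (F : fusion_system T).
Variable p : nat.
Hypotheses (pT : p.-group T) (satF : saturated p F).
Hypotheses (nBT : B <| T) (cBB : abelian B) (rTB : rigid T B).
Implicit Types (P Q R : {group gT}) (f g : gT -> gT).

Let BT : B \subset T := normal_sub nBT.

(** [B] is abelian, so it centralizes [R1] and lies in N_φ for φ = [k]; thus [k] extends to [B], and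
    [rigid_im] shows that the extension maps [B] onto itself. *)
Lemma fully_normalized_sub R1 R k :
    R1 \subset B -> fully_normalized F R -> is_fiso F R1 R k ->
  R \subset B.
Proof.
move=> R1B fnR isok; have [R1T RT] := fiso_sub isok.
have [fcR _] := (proj1 satF) R RT fnR.
have [|g homg eqkg] := sat_ext satF (H := B) isok fcR.
  apply/subsetP=> b Bb; have CB x : x \in R1 -> x ^ b^-1 = x.
    move=> /(subsetP R1B) Bx; apply/conjg_fixP/commgP.
    by apply: (centsP cBB); rewrite ?groupV.
  rewrite inE inE (subsetP BT) //=; apply/andP; split.
    rewrite -groupV; apply/normP; rewrite -[RHS]imset_id.
    by apply: eq_in_imset => x /CB.
  apply/exists_inP; exists 1; first exact: (group1 (conj_aut R @* 'N_T(R))%G).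
  by apply/forall_inP=> x R1x; rewrite CB // perm1.
have [gM inj_g gT'] := fs_inj homg.
have gB : g @: B = B.
  apply: rigid_im rTB _ _ _ => //.
  by apply/subsetP=> _ /imsetP[x Bx ->]; apply: gT'.
rewrite -(fiso_im isok) -gB; apply/subsetP=> _ /imsetP[x R1x ->].
by rewrite eqkg // imset_f // (subsetP R1B).
Qed.

Lemma hom_into_sub P f : F P T f -> f @: P \subset B -> P \subset B.
Proof.
have [m] := ubnP (#|B| - #|P :&: B|); elim: m P f => // m IHm P f ltm homf fPB.
have [PT _] := fs_obj homf; apply/negPn/negP=> nPB.
have [T4 _ Tinv T22] := rTB.
(* [P] embeds in the abelian group [B]. *)
have cPP : abelian P.
  apply/centsP=> x Px y Py; apply: (hom_inj homf); rewrite ?groupM //.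
  rewrite !(hom_M homf) //; apply: (centsP cBB).
    by apply: (subsetP fPB); apply: imset_f.
  by apply: (subsetP fPB); apply: imset_f.
have [x Px [nBx Bx2]] : exists2 x, x \in P & x \notin B /\ x ^+ 2 \in B.
  have /subsetPn[y Py nBy] := nPB.
  have [y2|ny2] := boolP (y ^+ 2 \in B); first by exists y.
  exists (y ^+ 2); first exact: groupX.
  by rewrite -expgM; split; last by apply: T4; apply: (subsetP PT).
pose R0 := (P :&: B)%G; pose R := <<x |: R0>>%G.
have Rx : x \in R by rewrite mem_gen // !inE eqxx.
have R0R : R0 \subset R by rewrite sub_gen // subsetUr.
have RP : R \subset P by rewrite gen_subG subUset sub1set Px subsetIl.
have R0x r : r \in R0 -> r ^ x = r.
  by case/setIP=> Pr _; apply/conjg_fixP/commgP/(centsP cPP).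
have Tx : x \in T by apply: (subsetP PT).
have [R1 fR] : exists R1 : {group gT}, f @: R = R1.
  apply: (@hom_group _ _ F R T); apply: (hom_restr homf) => //.
  apply/subsetP=> _ /imsetP[y Ry ->]; apply: (hom_mem homf).
  exact: (subsetP RP).
have R1B : R1 \subset B by rewrite -fR (subset_trans _ fPB) // imsetS.
have homfR : F R R1 f.
  by apply: (hom_restr homf) => //; rewrite ?fR // (subset_trans R1B).
have [l [isol fl lf]] := fiso_inv (hom_fiso homfR fR).
have RT := subset_trans RP PT.
have [Q fnQ [q isoq]] := ex_fully_normalized F RT.
have QB := fully_normalized_sub R1B fnQ (fiso_comp isol isoq).
have fcRQ : fconj F R Q by exists q.
have [g homg gR] := ext_normalizer pT satF fnQ fcRQ.
(* [N] describes N_B(R): such a [b] centralizes [R0], so only its effect on [x] matters. *)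
pose N b := b \in B /\ [~ b, x] \in R0.
have NN b : N b -> b \in 'N_T(R)%G.
  case=> Bb R0b; rewrite !inE (subsetP BT) //= -genJ gen_subG.
  apply/subsetP=> _ /imsetP[y /setU1P[->|R0y] ->].
    by rewrite conjg_mulR groupM // (subsetP R0R) // -invg_comm groupV.
  suffices -> : y ^ b = y by apply: (subsetP R0R).
  by apply/conjg_fixP/commgP/(centsP cBB) => //; case/setIP: R0y.
have RN : R \subset 'N_T(R)%G by rewrite subsetI RT normG.
(* Otherwise [g] maps the group generated by [R] and [b] into [B], and this group meets [B] in more
   than [R0]. Induction would place it, and so [x], in [B]. Hence N_B(R) / R0 embeds in T / B. *)
have gNB b : N b -> g b \in B -> b \in R0.
  move=> Nb gb; have [Bb _] := Nb; apply/negPn/negP=> nR0b.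
  pose R' := <<b |: R>>%G; have R'N : R' \subset 'N_T(R)%G.
    by rewrite gen_subG subUset sub1set NN.
  have R'T : R' \subset T := subset_trans R'N (subsetIl _ _).
  have gR'B : g @: R' \subset B.
    apply: (hom_gen homg); first by rewrite subUset sub1set NN.
    by rewrite imsetU1 subUset sub1set gb gR.
  have RR' : R \subset R' by rewrite sub_gen // subsetUr.
  have homgR' : F R' T g.
    by apply: (hom_restr homg) => //; apply: subset_trans gR'B BT.
  case/negP: nBx; apply: (subsetP (IHm R' g _ homgR' gR'B)); last first.
    exact: (subsetP RR').
  have ltR : #|R0| < #|R' :&: B|.
    apply/proper_card/properP; split.
      by rewrite subsetI subsetIr andbT (subset_trans R0R).
    by exists b; rewrite // inE Bb mem_gen // !inE eqxx.
  rewrite -ltnS; apply: leq_trans ltm.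
  by rewrite ltnS ltn_sub2l // (leq_trans ltR) // subset_leq_card ?subsetIr.
have gRB r : r \in R -> g r \in B.
  by move=> Rr; apply: (subsetP QB); rewrite -gR imset_f.
have [c [u [h [[Bc Bu Bh] [cx c4] [u2 ux uxc] [h4 hx] [h2 uxh]]]]] :=
  Tinv x Tx nBx Bx2.
have cB a b : a \in B -> b \in B -> commute a b by move=> Ba Bb; apply: (centsP cBB).
have Nc : N c by split; rewrite // (eqP (introT conjg_fixP cx)).
have R0c4 : c ^+ 4 \in R0.
  apply: gNB; last first.
    by rewrite (hom_X _ homg) ?NN //; apply: T4; apply: (hom_mem homg); apply: NN.
  split; rewrite ?groupX //; suffices -> : [~ c ^+ 4, x] = 1 by [].
  by apply/eqP/conjg_fixP; rewrite conjXg cx.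
have Nu : N u by split=> //; apply: (subsetP _ _ uxc); rewrite cycle_subG.
have nR0 b : [~ b, x] != 1 -> b \notin R0.
  by apply: contra => /R0x /conjg_fixP ->.
(* [k] is to generate, with [u], a four-group modulo [R0]. Take [h] if [h ^+ 2] is in [R0], since
   [[~ h, x] = h ^+ 2]; otherwise take [h ^+ 2], which [x] centralizes. Non-membership in [R0] comes
   from moving [x], or from the case assumption for [h ^+ 2] itself. *)
have [k [Nk k2 [kR0 ukR0] [cukR0 ck4]]] : exists k, [/\ N k, k ^+ 2 \in R0,
    k \notin R0 /\ u * k \notin R0 & c * (u * k) \notin R0 /\
    (c * k \in R0 -> (c * k) ^+ 4 != 1)].
  have cE b : b \in B -> [~ c * b, x] = [~ b, x].
    by move=> Bb; rewrite commMgJ (eqP (introT conjg_fixP cx)) conj1g mul1g.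
  have BJ b : b \in B -> [~ b, x] \in B.
    by move=> Bb; rewrite groupM ?groupV // memJ_norm // (subsetP (normal_norm nBT)).
  have uE b : b \in B -> [~ u * b, x] = [~ u, x] * [~ b, x].
    move=> Bb; rewrite commMgJ; congr (_ * _).
    by apply/conjg_fixP/commgP/cB => //; apply: BJ.
  have [R0h2|nR0h2] := boolP (h ^+ 2 \in R0).
    exists h; have hx1 : [~ h, x] != 1 by rewrite hx.
    have uhx1 : [~ u * h, x] != 1.
      rewrite uE // hx; apply: contra uxh => /eqP uh1; apply/eqP.
      by apply: (mulIg (h ^+ 2)); rewrite uh1 -expgD h4.
    split=> //; [by split; rewrite ?hx|by split; apply: nR0|split].
      by apply: nR0; rewrite cE ?groupM.
    by move=> R0ch; have := nR0 (c * h); rewrite cE // hx1 R0ch => /(_ isT).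
  have h2x : [~ h ^+ 2, x] = 1.
    apply/eqP/conjg_fixP; rewrite conjXg conjg_mulR hx -expgS -expgM.
    by rewrite (expgD h 4 2) h4 mul1g.
  exists (h ^+ 2); split.
  - by split; rewrite ?groupX // h2x.
  - by rewrite -expgM h4.
  - by split; rewrite // nR0 // uE ?groupX // h2x mulg1.
  split; first by rewrite nR0 // cE ?groupM ?groupX // uE ?groupX // h2x mulg1.
  move=> _; rewrite expgMn; last by apply: cB; rewrite ?groupX.
  by rewrite -[(h ^+ 2) ^+ 4]expgM (expgM h 4 2) h4 expg1n mulg1.
have [Bk _] := Nk.
have gM a b : N a -> N b -> g (a * b) = g a * g b.
  by move=> Na Nb; apply: (hom_M homg); apply: NN.
have gC a b : N a -> N b -> commute (g a) (g b).
  by move=> Na Nb; rewrite /commute -!gM // cB; case: Na; case: Nb.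
have NM a b : N a -> N b -> N (a * b).
  case=> Ba R0a [Bb R0b]; split; first exact: groupM.
  rewrite commMgJ groupM // memJ_norm //.
  by apply: (subsetP _ _ Bb); rewrite cents_norm // (sub_abelian_cent2 cBB) // subsetIr.
have NT b : N b -> g b \in T by move=> Nb; apply: (hom_mem homg); apply: NN.
have nB b : N b -> b \notin R0 -> g b \notin B by move=> Nb; apply/contra/gNB.
have uR0 := nR0 _ ux.
have g1 a b : N a -> N b -> [~ g a, g b] \in B.
  by move=> Na Nb; rewrite (eqP (introT commgP (gC _ _ Na Nb))).
(* [g u] and [g k] generate a four-group of T / B commuting with [g c], so modulo [B] the element
   [g c] is one of its four members. *)
have [] := T22 (g u) (g k) (g c) (NT _ Nu) (NT _ Nk) (NT _ Nc)
  (g1 _ _ Nu Nk) (g1 _ _ Nu Nc) (g1 _ _ Nk Nc).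
- by rewrite -(hom_X _ homg) ?NN // u2 (hom_1 homg) group1.
- by rewrite -(hom_X _ homg) ?NN // gRB // (subsetP R0R).
- exact: nB.
- exact: nB.
- by rewrite -gM // nB //; apply: NM.
move=> gc gk4.
(* [g r] lies in [B] and is fixed by [g u] and [g k], because [r], [u], [k] commute in [B]. *)
have R04 r : N r -> r \in R0 -> r ^+ 4 = 1.
  move=> Nr R0r; have RTr : r \in 'N_T(R)%G := NN r Nr.
  apply: (hom_inj homg); rewrite ?groupX //.
  rewrite (hom_X _ homg) // (hom_1 homg) gk4 //; first by apply: gRB; apply: (subsetP R0R).
    by apply/conjg_fixP/commgP/gC.
  by apply/conjg_fixP/commgP/gC.
have Nck := NM _ _ Nc Nk; have Nuk := NM _ _ Nu Nk.
case/or4P: gc => [gc|gcu|gck|gcuk].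
- by case/eqP: c4; apply: R04 => //; apply: gNB.
- have R0cu : c * u \in R0 by apply: gNB; [apply: NM | rewrite gM].
  case/negP: ux; apply/conjg_fixP; have := R0x _ R0cu.
  by rewrite conjMg cx => /mulgI.
- have R0ck : c * k \in R0 by apply: gNB; rewrite ?gM.
  by case/eqP: (ck4 R0ck); apply: R04.
- by case/negP: cukR0; apply: gNB; [apply: NM | rewrite gM // gM].
Qed.

(** The inverse of [f] on the image of [<[x]>] is a morphism into [B], so [hom_into_sub] places that
    image in [B]. *)
Lemma rigid_strongly_closed : strongly_closed F B.
Proof.
move=> P f x homf Px Bx; have xP : <[x]> \subset P by rewrite cycle_subG.
have [PT _] := fs_obj homf.
have fxT : f @: <[x]> \subset T.
  apply/subsetP=> _ /imsetP[y xy ->]; apply: (hom_mem homf).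
  exact: (subsetP xP).
have homfx : F <[x]>%G T f by apply: (hom_restr homf).
have [R fR] := hom_group homfx.
have [h [isoh fh hf]] := fiso_inv (hom_fiso homfx fR).
have hR : h @: R \subset B by rewrite (fiso_im isoh) cycle_subG.
apply: (subsetP (hom_into_sub (hom_widen (proj1 isoh)) hR)).
by rewrite -fR imset_f ?cycle_id.
Qed.

Theorem rigid_fnormal : fnormal F B.
Proof. exact: strongly_closed_fnormal pT satF nBT cBB rigid_strongly_closed. Qed.

End StronglyClosed.

(** * The action of D_8 *)

Lemma card_nonabelian8 (gT : finGroupType) (H : {group gT}) :
  (#|H| %| 8)%N -> ~~ abelian H -> #|H| = 8.
Proof.
move=> /(dvdn_pfactor _ 3 (isT : prime 2))[m m3 oH]; apply: contraNeq => neq8.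
have pH : 2.-group H by rewrite /pgroup oH pnatX.
apply: (p2group_abelian pH); rewrite oH pfactorK //.
by move: m3 neq8; rewrite oH leq_eqVlt => /predU1P[->|].
Qed.

(** The group generated by [x], [y], [z] is abelian, hence proper of order at most 4, and so equals
    the four-group [V]. Each member of [V] is its own inverse, which gives the product form of the
    conclusion. *)
Lemma involutions_nonabelian8 (gT : finGroupType) (H : {group gT}) x y z :
    #|H| = 8 -> ~~ abelian H -> x \in H -> y \in H -> z \in H ->
    commute x y -> commute x z -> commute y z ->
    x ^+ 2 = 1 -> y ^+ 2 = 1 -> x != 1 -> y != 1 -> x * y != 1 ->
  [|| z == 1, z * x == 1, z * y == 1 | z * (x * y) == 1].
Proof.
move=> oH nabH Hx Hy Hz cxy cxz cyz x2 y2 nx ny nxy.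
pose K := <<[set x; y; z]>>%G; pose V := [set 1; x; y; x * y].
have xx : x * x = 1 by rewrite -[RHS]x2.
have yy : y * y = 1 by rewrite -[RHS]y2.
have xNy : x != y by apply: contra nxy => /eqP->; rewrite yy.
have xNxy : x != x * y.
  by apply: contra ny => /eqP e; rewrite -(inj_eq (mulgI x)) -e mulg1.
have yNxy : y != x * y.
  by apply: contra nx => /eqP e; rewrite -(inj_eq (mulIg y)) -e mul1g.
have oV : #|V| = 4.
  rewrite /V -!setUA !cardsU1 cards1 !inE !negb_or ![1 == _]eq_sym.
  by rewrite nx ny nxy xNy xNxy yNxy.
have KH : K \subset H by rewrite gen_subG !subUset !sub1set Hx Hy.
have abK : abelian K.
  rewrite abelian_gen; apply/centsP=> a; rewrite !inE -orbA.
  by case/or3P=> /eqP-> b; rewrite !inE -orbA => /or3P[] /eqP->; try exact: commute_sym.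
have VK : V \subset K.
  have [Kx Ky] : x \in K /\ y \in K by split; rewrite mem_gen // !inE eqxx ?orbT.
  by rewrite !subUset !sub1set group1 Kx Ky groupM.
have K4 : #|K| <= 4.
  have := cardSg KH; rewrite oH => /(dvdn_pfactor _ 3 (isT : prime 2))[m m3 oK].
  move: m3; rewrite leq_eqVlt => /predU1P[m3|]; last first.
    by rewrite oK -[4]/(2 ^ 2)%N leq_exp2l.
  case/negP: nabH; suffices -> : H = K by [].
  by apply/val_inj/esym/eqP; rewrite /= eqEcard KH oH oK m3.
have : z \in V.
  suffices -> : V = K by rewrite mem_gen // !inE eqxx orbT.
  by apply/eqP; rewrite eqEcard VK oV.
rewrite !inE -!orbA => /or4P[] /eqP->; rewrite ?eqxx ?xx ?yy ?eqxx ?orbT //.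
suffices -> : x * y * (x * y) = 1 by rewrite eqxx !orbT.
by rewrite {2}cxy mulgA -(mulgA x) yy mulg1 xx.
Qed.

(** * Coordinates on A and the dihedral action *)

Section Lattice.

Variables (n : nat) (gT : finGroupType) (S A : {group gT}) (v1 v2 v3 s t : gT).
Hypothesis n_ge3 : (3 <= n)%N.
Hypothesis defA : <[v1]> \x <[v2]> \x <[v3]> = A.
Hypotheses (o1 : #[v1] = (2 ^ n)%N) (o2 : #[v2] = (2 ^ n)%N).
Hypothesis (o3 : #[v3] = (2 ^ n)%N).
Hypothesis defS : A <*> <<[set s; t]>> = S.
Hypothesis nAS : A <| S.
Hypothesis oSA : #|S / A| = 8.
Hypotheses (v1t : v1 ^ t = v3^-1) (v2t : v2 ^ t = v2^-1) (v3t : v3 ^ t = v1^-1).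
Hypotheses (v1s : v1 ^ s = v2) (v2s : v2 ^ s = v3).
Hypothesis v3s : v3 ^ s = v1 * v2^-1 * v3.

Local Notation q := (2 ^ n)%N.

Let q_gt1 : (1 < q)%N.
Proof. by rewrite -{1}(expn0 2) ltn_exp2l //; apply: leq_trans n_ge3. Qed.

Lemma expgZD (v : gT) (x y : 'Z_q) : #[v] = q -> v ^+ (x + y)%R = v ^+ x * v ^+ y.
Proof.
move=> ov; have -> : (x + y)%R = ((x + y) %% q)%N :> nat.
  by congr (_ %% _)%N; apply: Zp_cast.
have vq : v ^+ q = 1 by rewrite -ov expg_order.
by rewrite expg_mod // expgD.
Qed.

Lemma expgZn (v : gT) k : #[v] = q -> v ^+ (k%:R : 'Z_q)%R = v ^+ k.
Proof. by move=> ov; rewrite val_Zp_nat // -ov expg_mod_order. Qed.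

Let vcomm : [/\ commute v1 v2, commute v1 v3 & commute v2 v3].
Proof.
have [[B _ B12 _]] := dprodP defA; rewrite B12 => _ c3 _.
have [_ Bm c2 _] := dprodP B12.
have vB1 : v1 \in B by rewrite -Bm -[X in X \in _]mulg1 mem_mulg ?cycle_id.
have vB2 : v2 \in B by rewrite -Bm -[X in X \in _]mul1g mem_mulg ?cycle_id.
have [v1B v2B v3B] := And3 (cycle_id v1) (cycle_id v2) (cycle_id v3).
split.
- by apply: commute_sym; apply: (centsP c2).
- by apply: commute_sym; apply: (centsP c3).
- by apply: commute_sym; apply: (centsP c3).
Qed.

(** Exponents are taken in ['Z_q] so that identities in [A] become ring identities. *)
Definition vec (x y z : 'Z_q) : gT := v1 ^+ x * v2 ^+ y * v3 ^+ z.
Arguments vec (_ _ _)%_R.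

Lemma vecM x y z x' y' z' :
  vec x y z * vec x' y' z' = vec (x + x') (y + y') (z + z').
Proof.
have [c12 c13 c23] := vcomm; rewrite /vec !expgZD // !mulgA.
have -> : v1 ^+ x * v2 ^+ y * v3 ^+ z * v1 ^+ x' =
          v1 ^+ x * v1 ^+ x' * v2 ^+ y * v3 ^+ z.
  rewrite -!mulgA; congr (_ * _).
  rewrite (commuteX2 z x' (commute_sym c13)) !mulgA; congr (_ * _).
  exact: (commuteX2 y x' (commute_sym c12)).
rewrite -!mulgA; do 3!congr (_ * _); rewrite !mulgA; congr (_ * _).
exact: (commuteX2 z y' (commute_sym c23)).
Qed.

Lemma vec0 : vec 0 0 0 = 1.
Proof. by rewrite /vec !mulg1. Qed.

Lemma vecV x y z : (vec x y z)^-1 = vec (- x) (- y) (- z).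
Proof. by apply/eqP; rewrite eq_invg_mul vecM !addrN vec0. Qed.

Lemma vecX x y z k : vec x y z ^+ k = vec (x * k%:R) (y * k%:R) (z * k%:R).
Proof.
elim: k => [|k IHk]; first by rewrite !mulr0 vec0.
by rewrite expgS IHk vecM mulrS !mulrDr !mulr1.
Qed.

Lemma gens_vec : [/\ v1 = vec 1 0 0, v2 = vec 0 1 0 & v3 = vec 0 0 1].
Proof.
have v1Z (v : gT) : #[v] = q -> v ^+ (1%R : 'Z_q) = v.
  by move/expgZn => /(_ 1%N); rewrite expg1.
by rewrite /vec !v1Z // !mulg1 !mul1g.
Qed.

Lemma vecXz x y z (k : 'Z_q) : vec x y z ^+ k = vec (x * k) (y * k) (z * k).
Proof. by rewrite vecX natr_Zp. Qed.

Lemma vecJt x y z : vec x y z ^ t = vec (- z) (- y) (- x).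
Proof.
have [e1 e2 e3] := gens_vec; rewrite {1}/vec !conjMg !conjXg v1t v2t v3t.
rewrite {1}e3 e2 e1 !vecV !vecXz !vecM; congr vec; ring.
Qed.

Lemma vecJtV x y z : vec x y z ^ t^-1 = vec (- z) (- y) (- x).
Proof. by apply: (canLR (conjgK t)); rewrite vecJt !opprK. Qed.

Lemma vecJs x y z : vec x y z ^ s = vec z (x - z) (y + z).
Proof.
have [e1 e2 e3] := gens_vec; rewrite {1}/vec !conjMg !conjXg v1s v2s v3s.
rewrite e3 e2 e1 !vecV !vecM !vecXz !vecM; congr vec; ring.
Qed.

Lemma vec_eq1 x y z : vec x y z = 1 -> [/\ x = 0, y = 0 & z = 0]%R.
Proof.
have [[B _ B12 _]] := dprodP defA; rewrite B12 => _ _ tiB.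
have [_ Bm _ ti12] := dprodP B12; rewrite /vec => E1.
have v0 (v : gT) (i : 'Z_q) : #[v] = q -> v ^+ i = 1 -> i = 0%R.
  move=> ov /eqP; rewrite -order_dvdn ov => qi; apply/val_inj.
  case: (posnP i) => // i0; move: qi; rewrite gtnNdvd //.
  by have := ltn_ord i; rewrite [X in (_ < X)%N]Zp_cast.
have Bxy : v1 ^+ x * v2 ^+ y \in B by rewrite -Bm mem_mulg ?mem_cycle.
have z1 : v3 ^+ z = 1.
  apply/set1gP; rewrite -tiB inE mem_cycle andbT.
  by rewrite (canRL (mulKg _) E1) mulg1 groupV.
have xy1 : v1 ^+ x * v2 ^+ y = 1 by rewrite -E1 z1 mulg1.
have y1 : v2 ^+ y = 1.
  apply/set1gP; rewrite -ti12 inE mem_cycle andbT.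
  by rewrite (canRL (mulKg _) xy1) mulg1 groupV mem_cycle.
have x1 : v1 ^+ x = 1 by rewrite -xy1 y1 mulg1.
by split; [apply: v0 o1 x1 | apply: v0 o2 y1 | apply: v0 o3 z1].
Qed.

Lemma vec_inj x y z x' y' z' :
  vec x y z = vec x' y' z' -> [/\ x = x', y = y' & z = z'].
Proof.
move=> Exx; have [] := @vec_eq1 (x - x')%R (y - y')%R (z - z')%R.
  by rewrite -vecM -vecV Exx mulgV.
by do 3!move/subr0_eq->.
Qed.

Lemma mem_vec x y z : vec x y z \in A.
Proof.
have [[B _ B12 _]] := dprodP defA; rewrite B12 => <- _ _.
have [_ <- _ _] := dprodP B12; by rewrite !mem_mulg ?mem_cycle.
Qed.

Lemma vecP a : a \in A -> exists x y z, a = vec x y z.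
Proof.
have [[B _ B12 _]] := dprodP defA; rewrite B12 => <- _ _.
have [_ <- _ _] := dprodP B12; case/mulsgP=> b c /mulsgP[d e].
case/cycleP=> i -> /cycleP[j ->] -> /cycleP[k ->] ->.
by exists i%:R%R, j%:R%R, k%:R%R; rewrite /vec !expgZn.
Qed.

Lemma lattice_abelian : abelian A.
Proof.
apply/centsP=> a /vecP[x [y [z ->]]] b /vecP[x' [y' [z' ->]]].
by rewrite /commute !vecM addrC (addrC y) (addrC z).
Qed.

(** [lam * 4] and [lam * 2] stand for 2^(n-1) and 2^(n-2), the coordinates of elements of order 2
    and 4. [ring] handles them through [lam * 8 = 0] alone. *)
Let lam : 'Z_q := (2 ^ (n - 3))%:R%R.

Lemma lam8 : (lam * 8 = 0)%R.
Proof.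
by rewrite -natrM -[8]/(2 ^ 3)%N -expnD subnK // pchar_Zp.
Qed.

Lemma lam4 : (lam * 4 != 0)%R.
Proof.
apply/eqP; rewrite -natrM -[4]/(2 ^ 2)%N -expnD => /(congr1 (@nat_of_ord _)).
rewrite val_Zp_nat // modn_small; first by apply/eqP; rewrite expn_eq0.
by rewrite ltn_exp2l // -{2}(subnK n_ge3) ltn_add2l.
Qed.

Lemma Z4 : (4 != 0 :> 'Z_q)%R.
Proof. by apply: contra lam4 => /eqP->; rewrite mulr0. Qed.

Lemma Z2_div4 (x : 'Z_q) : (x * 2 = 0 -> exists y, x = y * 4)%R.
Proof.
rewrite -{1}(natr_Zp x) -natrM => /(congr1 (@nat_of_ord _)).
rewrite val_Zp_nat // => /eqP; rewrite -/(dvdn _ _).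
rewrite -{1}(subnK (ltnW (ltnW n_ge3))) addn1 expnSr dvdn_pmul2r //.
have -> : (n - 1 = (n - 3) + 2)%N.
  by case: (n) n_ge3 => [|[|[|m]]] // _; rewrite !subSS !subn0 addn2.
rewrite expnD => /dvdnP[k xk]; exists (k * 2 ^ (n - 3))%:R%R.
by rewrite -(natr_Zp x) xk mulnA natrM.
Qed.

Let SN : S \subset 'N(A) := normal_norm nAS.

Let stS : s \in S /\ t \in S.
Proof.
rewrite -defS; split; apply: (subsetP (joing_subr _ _)).
  by rewrite mem_gen // !inE eqxx.
by rewrite mem_gen // !inE eqxx orbT.
Qed.

Lemma conj_aut_eq g h : g \in S -> h \in S ->
    (forall x y z, vec x y z ^ g = vec x y z ^ h) ->
  conj_aut A g = conj_aut A h.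
Proof.
move=> /(subsetP SN) Ng /(subsetP SN) Nh eqgh.
apply: (eq_Aut (A := A)) => [||a Aa]; rewrite ?Aut_aut //.
by rewrite !norm_conj_autE //; have [x [y [z ->]]] := vecP Aa.
Qed.

(** As automorphisms of [A], [s] and [t] satisfy the dihedral relations exactly, and [A] acts
    trivially on itself; so the image of [S] is the product of two cyclic groups. *)
Lemma conj_aut_st y : y \in S -> exists i j,
  [/\ (i < 4)%N, (j < 2)%N & conj_aut A y = conj_aut A (s ^+ i * t ^+ j)].
Proof.
have [Ss St] := stS => Sy; have [Ns Nt] := (subsetP SN _ Ss, subsetP SN _ St).
pose sg := conj_aut A s; pose ta := conj_aut A t.
have sgX i : conj_aut A (s ^+ i) = sg ^+ i by apply: morphX.
have taX i : conj_aut A (t ^+ i) = ta ^+ i by apply: morphX.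
have sg4 : sg ^+ 4 = 1.
  rewrite -sgX -(morph1 (conj_aut_morphism A)) /=.
  apply: conj_aut_eq; rewrite ?groupX // => x y' z.
  by rewrite conjg1 !expgS !conjgM !vecJs conjg1; congr vec; ring.
have ta2 : ta ^+ 2 = 1.
  rewrite -taX -(morph1 (conj_aut_morphism A)) /=.
  apply: conj_aut_eq; rewrite ?groupX // => x y' z.
  by rewrite conjg1 !expgS !conjgM !vecJt conjg1; congr vec; ring.
have sgta : sg ^ ta = sg^-1.
  have -> : sg^-1 = sg ^+ 3 by apply/eqP; rewrite eq_invg_mul -expgS sg4.
  rewrite -sgX -(morphJ (conj_aut_morphism A)) //=.
  apply: conj_aut_eq; rewrite ?groupJ ?groupX // => x y' z.
  by rewrite (conjgE s t) !expgS !conjgM vecJtV !vecJs vecJt conjg1; congr vec; ring.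
have imS : conj_aut A @* S = <[sg]> * <[ta]>.
  rewrite -norm_joinEr; last first.
    by rewrite cycle_subG; apply/normP; rewrite -cycleJ sgta cycleV.
  rewrite -defS morphimY ?normG //; last first.
    by rewrite gen_subG subUset !sub1set Ns Nt.
  rewrite morphim_gen; last by rewrite subUset !sub1set Ns Nt.
  have -> : conj_aut A @* A = 1.
    apply/trivgP; rewrite -(morphim_ker (conj_aut_morphism A)) ker_conj_aut.
    exact: morphimS lattice_abelian.
  rewrite joing1G morphimU !morphim_set1 //.
  by rewrite /cycle joing_idl joing_idr.
have : conj_aut A y \in <[sg]> * <[ta]> by rewrite -imS mem_morphim ?(subsetP SN).
case/mulsgP=> _ _ /cycleP[i ->] /cycleP[j ->] yE.
exists (i %% 4), (j %% 2); split; rewrite ?ltn_mod // yE.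
have -> : conj_aut A (s ^+ (i %% 4) * t ^+ (j %% 2)) =
    conj_aut A (s ^+ (i %% 4)) * conj_aut A (t ^+ (j %% 2)).
  by apply: morphM; apply: groupX.
by rewrite sgX taX !expg_mod.
Qed.

Lemma vecJ_st y : y \in S -> exists i j, [/\ (i < 4)%N, (j < 2)%N &
  forall x z w, vec x z w ^ y = vec x z w ^ (s ^+ i * t ^+ j)].
Proof.
move=> Sy; have [i [j [i4 j2 yE]]] := conj_aut_st Sy.
have [Ss St] := stS; exists i, j; split=> // x z w.
rewrite -!(@norm_conj_autE _ A) ?mem_vec ?yE // (subsetP SN) //.
by rewrite groupM ?groupX.
Qed.

Lemma cent_fix y x z w : y \in 'C(A) -> vec x z w ^ y = vec x z w.
Proof.
move/centP/(_ _ (mem_vec x z w)) => cyE; apply/conjg_fixP/commgP.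
exact: commute_sym.
Qed.

(** [s] and [t] do not commute on [v2], so S / C_S(A) is nonabelian; its order divides 8 and is
    therefore 8, the order of S / A. *)
Lemma lattice_cent : 'C_S(A) = A.
Proof.
have [Ss St] := stS; have nC : S \subset 'N('C_S(A)).
  by rewrite normsI ?normG ?norms_cent.
have AC : A \subset 'C_S(A) by rewrite subsetI (normal_sub nAS) /=; apply: lattice_abelian.
have oC : (#|S : 'C_S(A)| * #|'C_S(A) : A|)%N = 8.
  by rewrite Lagrange_index ?subsetIl // -card_quotient.
have nab : ~~ abelian (S / 'C_S(A)).
  apply/negP => abSC; have : [~ s, t] \in 'C_S(A).
    by apply: (subsetP (der1_min nC abSC)); apply: mem_commg.
  case/setIP=> _ Cst; have : vec 0 1 0 ^ (s * t) = vec 0 1 0 ^ (t * s).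
    by rewrite (commgC s t) 2!conjgM vecJt vecJs cent_fix // conjgM vecJt vecJs.
  rewrite !conjgM vecJt !vecJs vecJt => /vec_inj[/oppr_inj/eqP].
  by rewrite addr0 oner_eq0.
have d8 : (#|S / 'C_S(A)| %| 8)%N by rewrite card_quotient // -oC dvdn_mulr.
have o8 := card_nonabelian8 d8 nab.
apply/eqP; rewrite eqEsubset AC andbT -indexg_eq1 -(eqn_pmul2l (isT : (0 < 8)%N)).
by rewrite muln1 -[X in _ == X]oC -o8 card_quotient.
Qed.

Lemma mem_lattice y : y \in S ->
  (forall x z w, vec x z w ^ y = vec x z w) -> y \in A.
Proof.
move=> Sy yE; rewrite -lattice_cent inE Sy; apply/centP=> a /vecP[x [z [w ->]]].
by apply/commute_sym/commgP/conjg_fixP/yE.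
Qed.

Lemma vec_fix y x z w : y \in A -> vec x z w ^ y = vec x z w.
Proof. by rewrite -{1}lattice_cent => /setIP[_ /cent_fix]. Qed.

Lemma eq_act_lattice g h : g \in S -> h \in S ->
  (forall x z w, vec x z w ^ g = vec x z w ^ h) -> g^-1 * h \in A.
Proof.
move=> Sg Sh gh; apply: mem_lattice => [|x z w]; first by rewrite groupM ?groupV.
have AEg : vec x z w ^ g^-1 \in A by rewrite memJ_norm ?mem_vec // groupV (subsetP SN).
by rewrite conjgM; have [x' [z' [w' eE]]] := vecP AEg; rewrite eE -gh -eE conjgKV.
Qed.

Lemma quotient_nonabelian : ~~ abelian (S / A).
Proof.
have [Ss St] := stS; apply/negP => abSA; have : [~ s, t] \in A.
  by apply: (subsetP (der1_min SN abSA)); apply: mem_commg.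
move=> Ast; have : vec 0 1 0 ^ (s * t) = vec 0 1 0 ^ (t * s).
  by rewrite (commgC s t) 2!conjgM vecJt vecJs vec_fix // conjgM vecJt vecJs.
rewrite !conjgM vecJt !vecJs vecJt => /vec_inj[/oppr_inj/eqP].
by rewrite addr0 oner_eq0.
Qed.

Let conjE := (@expgS gT, @expg0 gT, @mulg1 gT, @mul1g gT, @conjgM gT,
  vecJs, vecJt, @conjg1 gT).

Lemma expg4_lattice y : y \in S -> y ^+ 4 \in A.
Proof.
move=> Sy; apply: mem_lattice => [|x z w]; first exact: groupX.
have [i [j [i4 j2 yE]]] := vecJ_st Sy.
case: i i4 yE => [|[|[|[|i]]]] //; case: j j2 => [|[|j]] // _ _ yE.
all: rewrite ?(yE, conjE); congr vec; ring.
Qed.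

Lemma sqr1_expg4 a : a \in A -> a ^+ 2 = 1 -> exists2 b, b \in A & a = b ^+ 4.
Proof.
case/vecP=> x [y [z ->]]; rewrite vecX => /vec_eq1[].
move=> /Z2_div4[x' ->] /Z2_div4[y' ->] /Z2_div4[z' ->].
by exists (vec x' y' z'); rewrite ?mem_vec // vecX.
Qed.

Lemma sqr_s_mod y : y \in S -> [~ s ^+ 2, y] \in A.
Proof.
have [Ss St] := stS => Sy.
have -> : [~ s ^+ 2, y] = (y * s ^+ 2)^-1 * (s ^+ 2 * y).
  by rewrite invMg commgEl conjgE !mulgA.
apply: eq_act_lattice; rewrite ?groupM ?groupX // => x z w.
have [i [j [i4 j2 yE]]] := vecJ_st Sy.
case: i i4 yE => [|[|[|[|i]]]] //; case: j j2 => [|[|j]] // _ _ yE.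
all: rewrite ?(yE, conjE); congr vec; ring.
Qed.

Lemma involution_cases y : y \in S -> y \notin A -> y ^+ 2 \in A ->
  exists i j, [/\ (i < 4)%N, (j == 1)%N || (j == 0)%N && (i == 2)%N &
  forall x z w, vec x z w ^ y = vec x z w ^ (s ^+ i * t ^+ j)].
Proof.
move=> Sy nAy Ay2; have [i [j [i4 j2 yE]]] := vecJ_st Sy.
exists i, j; split=> //; case: j j2 yE => [|[|j]] // _.
(* If [y] acted as [s] or [s ^+ 3], then [y ^+ 2] would act as [s ^+ 2], which moves [v1]. *)
case: i i4 => [|[|[|[|i]]]] // _ yE; have := vec_fix 1%R 0%R 0%R Ay2;
  rewrite ?(yE, conjE); last 2 first.
- by case/vec_inj=> e _ _; case/eqP: (oner_neq0 'Z_q); rewrite -[LHS]e; ring.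
- by case/vec_inj=> e _ _; case/eqP: (oner_neq0 'Z_q); rewrite -[LHS]e; ring.
by case/negP: nAy; apply: mem_lattice => // *; rewrite ?(yE, conjE).
Qed.

Lemma fixed_expg4 y : y \in S -> y \notin A -> y ^+ 2 \in A ->
  (forall x z w, vec x z w ^ y = vec x z w ^ (s ^+ 2)) \/
  {in A, forall a, a ^ y = a -> a ^ (s ^+ 2) = a -> a ^+ 4 = 1}.
Proof.
move=> Sy nAy Ay2; have [i [j [i4 ij yE]]] := involution_cases Sy nAy Ay2.
case/predU1P: ij => [j1|/andP[/eqP j0 /eqP i2]]; last first.
  by left=> x z w; rewrite yE j0 i2 mulg1.
right=> a Aa ya s2a.
(* A four-group has norm 0 on the lattice. *)
have prod1 : a * a ^ (s ^+ 2) * a ^ y * (a ^ (s ^+ 2)) ^ y = 1.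
  have [x [z [w ->]]] := vecP Aa.
  move: yE; rewrite {}j1 -vec0; case: i i4 => [|[|[|[|i]]]] // _ yE;
    by rewrite ?(yE, conjE) !vecM; congr vec; ring.
by rewrite -[RHS]prod1 !s2a !ya !expgS expg0 mulg1 !mulgA.
Qed.

Lemma eq_mod8 (k x y : 'Z_q) : (x = y + lam * 8 * k -> x = y)%R.
Proof. by rewrite lam8 mul0r addr0. Qed.

(** The pair [m], [k] is a certificate: it rewrites the nonzero [lam * 4] as a multiple of [x - y]
    modulo [lam * 8 = 0]. The tactics below search small values. *)
Lemma neq_mod8 (m k x y : 'Z_q) :
  (lam * 4 = m * (x - y) + lam * 8 * k -> x <> y)%R.
Proof.
by move=> eq4 xy; case/eqP: lam4; rewrite eq4 xy subrr mulr0 lam8 mul0r addr0.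
Qed.

Ltac ring8 := first [ring | apply: (eq_mod8 (k := 1%R)); ring
  | apply: (eq_mod8 (k := (-1)%R)); ring | apply: (eq_mod8 (k := 2%R)); ring
  | apply: (eq_mod8 (k := (-2)%R)); ring ].

Ltac neq8 := first
  [ apply: (@neq_mod8 1%R 0%R); ring | apply: (@neq_mod8 (-1)%R 0%R); ring
  | apply: (@neq_mod8 1%R 1%R); ring | apply: (@neq_mod8 (-1)%R 1%R); ring
  | apply: (@neq_mod8 1%R (-1)%R); ring | apply: (@neq_mod8 (-1)%R (-1)%R); ring].

Ltac absurd8 := first [move=> + _ _; neq8 | move=> _ + _; neq8 | move=> _ _; neq8].

Ltac witness yE c4 := split;
  [ by rewrite !mem_vec
  | by split; [rewrite ?(yE, conjE); congr vec; ring | exact: c4]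
  | split; [ rewrite vecX -vec0; congr vec; ring8
           | apply/eqP; rewrite commgEl ?(yE, conjE) vecV vecM => /vec_eq1[]; absurd8
           | apply/cycleP; exists (2 ^ (n - 3))%N;
             rewrite commgEl !vecX ?(yE, conjE) vecV vecM -/lam; congr vec; ring8 ]
  | split; [ rewrite vecX -vec0; congr vec; ring8
           | rewrite commgEl vecX ?(yE, conjE) vecV !vecM; congr vec; ring8 ]
  | split; apply/eqP;
    [ rewrite vecX => /vec_eq1[]; absurd8
    | rewrite commgEl vecX ?(yE, conjE) vecV vecM => /vec_inj[]; absurd8]].

Lemma dihedral_witness x : x \in S -> x \notin A -> x ^+ 2 \in A ->
  exists c u h, involution_witness A x c u h.
Proof.
move=> Sx nAx Ax2; have [i [j [i4 ij yE]]] := involution_cases Sx nAx Ax2.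
have c4 y z : vec 1 y z ^+ 4 != 1.
  by apply/eqP; rewrite vecX => /vec_eq1[e _ _]; case/eqP: Z4; rewrite -[RHS]e mul1r.
have c4' y z : vec y 1 z ^+ 4 != 1.
  by apply/eqP; rewrite vecX => /vec_eq1[_ e _]; case/eqP: Z4; rewrite -[RHS]e mul1r.
(* For [s ^+ 2] the basis is w0 = (1,0,0), its image (0,0,1), and w1 = (-1,1,0), which is
   inverted. *)
case/predU1P: ij yE => [->|/andP[/eqP-> /eqP->]]; last first.
  move=> yE; exists (vec 1 0 1), (vec (lam * 4) 0 0), (vec (- (lam * 2)) (lam * 2) 0).
  witness yE c4.
(* For the reflections [s ^+ i * t], i = 0, 1, 2, 3, w0 is (1,0,0), (1,0,0), (0,1,0), (0,1,0) and w1
   is (0,1,0), (1,0,1), (1,0,0), (1,0,1). For i = 2, [c] is the inverse of w0 * w0 ^ x. *)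
case: i i4 => [|[|[|[|i]]]] // _ yE.
- exists (vec 1 0 (-1)), (vec (lam * 4) 0 0), (vec 0 (lam * 2) 0); witness yE c4.
- exists (vec 1 (-1) 0), (vec (lam * 4) 0 0), (vec (lam * 2) 0 (lam * 2)).
  by witness yE c4.
- exists (vec 1 (-2) 1), (vec 0 (lam * 4) 0), (vec (lam * 2) 0 0); witness yE c4.
- exists (vec 0 1 (-1)), (vec 0 (lam * 4) 0), (vec (lam * 2) 0 (lam * 2)).
  by witness yE c4'.
Qed.

Lemma four_group_lattice : {in S & &, forall y1 y2 y3,
        [~ y1, y2] \in A -> [~ y1, y3] \in A -> [~ y2, y3] \in A ->
        y1 ^+ 2 \in A -> y2 ^+ 2 \in A ->
        y1 \notin A -> y2 \notin A -> y1 * y2 \notin A ->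
        [|| y3 \in A, y3 * y1 \in A, y3 * y2 \in A | y3 * (y1 * y2) \in A]}.
Proof.
have cA y : y \in S -> (coset A y == 1) = (y \in A).
  move=> /(subsetP SN) Ny; apply/eqP/idP=> [/(coset_idr Ny)|/coset_id] //.
move=> y1 y2 y3 S1 S2 S3 c12 c13 c23 q1 q2 n1 n2 n12.
have [N1 N2 N3] := And3 (subsetP SN _ S1) (subsetP SN _ S2) (subsetP SN _ S3).
have com a b : a \in S -> b \in S -> [~ a, b] \in A ->
    commute (coset A a) (coset A b).
  move=> Sa Sb; rewrite -cA ?groupR // morphR ?(subsetP SN) //.
  by move/commgP.
have cM a b : a \in S -> b \in S -> coset A (a * b) = coset A a * coset A b.
  by move=> Sa Sb; rewrite morphM ?(subsetP SN).
have c2 a : a \in S -> a ^+ 2 \in A -> coset A a ^+ 2 = 1.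
  by move=> Sa Aa2; rewrite -[LHS]/(coset A a * coset A a) -cM // coset_id.
rewrite -!cA ?groupM // !cM ?groupM //.
have S12 := groupM S1 S2.
by apply: (involutions_nonabelian8 oSA quotient_nonabelian);
  rewrite ?mem_quotient -?cM ?cA //; do ?[exact: com | exact: c2].
Qed.

(** [s ^+ 2] is central modulo [A], so it lies in the self-centralizing four-group and also fixes
    [a]. [y1] and [y2] cannot both act as [s ^+ 2], or [y1 * y2] would act trivially; [fixed_expg4]
    applies to the other one. *)
Lemma four_group_fixed : {in S &, forall y1 y2,
        [~ y1, y2] \in A -> y1 ^+ 2 \in A -> y2 ^+ 2 \in A ->
        y1 \notin A -> y2 \notin A -> y1 * y2 \notin A ->
        {in A, forall a, a ^ y1 = a -> a ^ y2 = a -> a ^+ 4 = 1}}.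
Proof.
move=> y1 y2 S1 S2 c12 q1 q2 n1 n2 n12 a Aa a1 a2.
have [Ss _] := stS; have Ss2 : s ^+ 2 \in S by apply: groupX.
have cs y : y \in S -> [~ y, s ^+ 2] \in A.
  by move=> Sy; rewrite -invg_comm groupV sqr_s_mod.
have as2 : a ^ (s ^+ 2) = a.
  have fixA b : b \in A -> a ^ b = a.
    by move=> Ab; have [x [y [z ->]]] := vecP Aa; apply: vec_fix.
  have fixM b y : a ^ y = a -> b * y \in A -> a ^ b = a.
    by move=> ay Aby; apply: (conjg_inj y); rewrite -conjgM ay fixA.
  have := four_group_lattice S1 S2 Ss2 c12 (cs _ S1) (cs _ S2) q1 q2 n1 n2 n12.
  case/or4P=> [/fixA|/fixM|/fixM|/fixM] //; apply=> //.
  by rewrite conjgM a1.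
have [y1E|] := fixed_expg4 S1 n1 q1; last by apply.
have [y2E|] := fixed_expg4 S2 n2 q2; last by apply.
case/negP: n12; apply: mem_lattice => [|x z w]; first exact: groupM.
by rewrite conjgM y1E !conjE y2E !conjE; congr vec; ring.
Qed.

Theorem rigid_lattice : rigid S A.
Proof.
split.
- exact: expg4_lattice.
- exact: sqr1_expg4.
- exact: dihedral_witness.
move=> y1 y2 y3 S1 S2 S3 c12 c13 c23 q1 q2 n1 n2 n12; split.
  exact: four_group_lattice.
exact: four_group_fixed q1 q2 n1 n2 n12.
Qed.

End Lattice.

(** * Transport along an isomorphism *)

Section Transport.

Variables (gT hT : finGroupType) (S A : {group gT}) (B : {group hT}).
Variable j : gT -> hT.
Hypotheses (nAS : A <| S) (centA : 'C_S(A) = A) (cAA : abelian A).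
Hypothesis rSA : rigid S A.
Hypotheses (jM : {in A &, {morph j : x y / x * y}}) (inj_j : {in A &, injective j}).
Hypothesis jA : j @: A = B.

Definition acts_like (T : {group hT}) : Prop :=
  {in T, forall g, exists2 g', g' \in S & {in A, forall a, j a ^ g = j (a ^ g')}}.

Let phi := Morphism jM.

Let memJ a g : a \in A -> g \in S -> a ^ g \in A.
Proof. by move=> Aa Sg; rewrite memJ_norm // (subsetP (normal_norm nAS)). Qed.

Let jX k : {in A, {morph j : a / a ^+ k}}.
Proof. exact: (morphX phi). Qed.

Let j1 : j 1 = 1.
Proof. exact: (morph1 phi). Qed.

Let jV : {in A, {morph j : a / a^-1}}.
Proof. exact: (morphV phi). Qed.

Let jB a : a \in A -> j a \in B.
Proof. by move=> Aa; rewrite -jA imset_f. Qed.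

Let j_eq1 a : a \in A -> (j a == 1) = (a == 1).
Proof.
by move=> Aa; apply/eqP/eqP => [|-> //]; rewrite -{1}j1 => /inj_j; apply.
Qed.

Lemma transported_abelian : abelian B.
Proof.
rewrite -jA; apply/centsP=> _ /imsetP[a Aa ->] _ /imsetP[b Ab ->].
by rewrite /commute -!jM // (centsP cAA).
Qed.

(** Both [A] and [B] are self-centralizing, so membership in them can be read off the action.
    Pairing each element of [T] with one of [S] acting alike respects products, inverses,
    commutators and powers, and each clause of [rigid] is carried over. *)
Lemma rigid_transport (T : {group hT}) :
  B <| T -> 'C_T(B) = B -> acts_like T -> rigid T B.
Proof.
move=> nBT centB actT; have [S4 sqrA invS fourS] := rSA.
pose like g g' := g' \in S /\ {in A, forall a, j a ^ g = j (a ^ g')}.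
have likeP g : g \in T -> exists g', like g g'.
  by case/actT=> g' Sg' gE; exists g'.
have likeB g g' : g \in T -> like g g' -> (g \in B) = (g' \in A).
  move=> Tg [Sg' gE]; rewrite -centB -centA !inE Tg Sg' /=.
  apply/centP/centP=> [cg a Aa|cg _ /[!(esym jA)]/imsetP[a Aa ->]].
    apply/commute_sym/commgP/conjg_fixP; apply: inj_j; rewrite ?memJ //.
    rewrite -gE //; apply/conjg_fixP/commgP/commute_sym.
    by apply: cg; apply: jB.
  apply/commute_sym/commgP/conjg_fixP; rewrite gE //; congr j.
  by apply/conjg_fixP/commgP/commute_sym/cg.
have likeM g g' h h' : like g g' -> like h h' -> like (g * h) (g' * h').
  move=> [Sg gE] [Sh hE]; split=> [|a Aa]; first exact: groupM.
  by rewrite !conjgM gE // hE // memJ.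
have likeV g g' : like g g' -> like g^-1 g'^-1.
  move=> [Sg gE]; split=> [|a Aa]; first by rewrite groupV.
  apply: (canLR (conjgK g)); rewrite gE ?conjgKV //.
  by rewrite memJ ?groupV.
have likeR g g' h h' : like g g' -> like h h' -> like [~ g, h] [~ g', h'].
  move=> gg hh; rewrite !commgEl !conjgE.
  apply: (likeM _ _ _ _ (likeV _ _ gg)).
  exact: (likeM _ _ _ _ (likeV _ _ hh) (likeM _ _ _ _ gg hh)).
have likeX g g' k : like g g' -> like (g ^+ k) (g' ^+ k).
  move=> gg; elim: k => [|k IHk]; last by rewrite !expgS; apply: likeM.
  by split=> [|a _]; rewrite ?group1 // !conjg1.
split.
- move=> y Ty; have [y' yy] := likeP y Ty.
  by rewrite (likeB _ _ (groupX 4 Ty) (likeX _ _ 4 yy)); apply: S4; case: yy.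
- rewrite -jA => _ /imsetP[a Aa ->] /eqP; rewrite -jX // j_eq1 ?groupX //.
  move/eqP/(sqrA a Aa)=> [b Ab ->]; exists (j b); last exact: jX.
  exact: imset_f.
- move=> x Tx; have [x' xx] := likeP x Tx; have [Sx' xE] := xx.
  rewrite (likeB _ _ Tx xx) (likeB _ _ (groupX 2 Tx) (likeX _ _ 2 xx)).
  move=> nx x2; have [c [u [h [[Ac Au Ah] [cx c4] [u2 ux uxc] [h4 hx] [h2 uxh]]]]] :=
    invS x' Sx' nx x2.
  have jR a : a \in A -> [~ j a, x] = j [~ a, x'].
    move=> Aa; rewrite !commgEl xE // -jV //; apply/esym/jM; first by rewrite groupV.
    exact: memJ.
  have AR a : a \in A -> [~ a, x'] \in A.
    by move=> Aa; rewrite commgEl groupM ?groupV ?memJ //.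
  exists (j c), (j u), (j h); split; first by rewrite !jB.
  + by rewrite xE // cx -jX // j_eq1 ?groupX.
  + rewrite jR // -jX // u2 j1 j_eq1 ?AR //; split=> //.
    case/cycleP: uxc => k ->.
    by rewrite (jX k (groupX 4 Ac)) (jX 4 Ac) mem_cycle.
  + by rewrite jR // -!jX // h4 hx.
  rewrite jR // -jX // j_eq1 ?groupX //; split=> //.
  by apply: contra uxh => /eqP/inj_j; rewrite AR ?groupX // => ->.
move=> y1 y2 y3 T1 T2 T3.
have [z1 yz1] := likeP y1 T1; have [z2 yz2] := likeP y2 T2.
have [z3 yz3] := likeP y3 T3.
have [S1 y1E] := yz1; have [S2 y2E] := yz2; have [S3 y3E] := yz3.
have yz12 := likeM _ _ _ _ yz1 yz2.
rewrite (likeB _ _ (groupR T1 T2) (likeR _ _ _ _ yz1 yz2)).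
rewrite (likeB _ _ (groupR T1 T3) (likeR _ _ _ _ yz1 yz3)).
rewrite (likeB _ _ (groupR T2 T3) (likeR _ _ _ _ yz2 yz3)).
rewrite (likeB _ _ T1 yz1) (likeB _ _ T2 yz2) (likeB _ _ T3 yz3).
rewrite (likeB _ _ (groupX 2 T1) (likeX _ _ 2 yz1)).
rewrite (likeB _ _ (groupX 2 T2) (likeX _ _ 2 yz2)).
rewrite (likeB _ _ (groupM T1 T2) yz12).
rewrite (likeB _ _ (groupM T3 T1) (likeM _ _ _ _ yz3 yz1)).
rewrite (likeB _ _ (groupM T3 T2) (likeM _ _ _ _ yz3 yz2)).
rewrite (likeB _ _ (groupM T3 (groupM T1 T2)) (likeM _ _ _ _ yz3 yz12)).
move=> c12 c13 c23 q1 q2 n1 n2 n12.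
have [-> fixed] := fourS z1 z2 z3 S1 S2 S3 c12 c13 c23 q1 q2 n1 n2 n12.
split=> //; rewrite -jA => _ /imsetP[a Aa ->].
rewrite y1E // y2E // => /inj_j a1 /inj_j a2.
rewrite -jX // fixed //; first by apply: a1 => //; apply: memJ.
by apply: a2 => //; apply: memJ.
Qed.

Lemma transport_fnormal (p : nat) (T : {group hT}) (F : fusion_system T) :
    p.-group T -> saturated p F -> B \subset T -> 'C_T(B) = B ->
    acts_like 'N_T(B)%G ->
  fnormal F B.
Proof.
move=> pT satF BT centB actN; have cBB := transported_abelian.
have nBN : B <| 'N_T(B) by rewrite normal_subnorm.
have centN : 'C_('N_T(B))(B) = B.
  apply/eqP; rewrite eqEsubset; apply/andP; split.
    by apply: subset_trans (setSI _ (subsetIl T 'N(B))) _; rewrite centB.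
  by rewrite subsetI normal_sub.
have rN : rigid 'N_T(B)%G B by apply: rigid_transport.
(* Otherwise some [g] outside N_T(B) normalizes N_T(B); conjugation by [g] embeds [B] in N_T(B), and
   [rigid_im] forces [B :^ g] to be [B]. *)
have nBT : B <| T.
  rewrite /normal BT; apply/setIidPl/eqP; rewrite eqEsubset subsetIl /=.
  apply/negPn/negP=> nTN; have ltN : 'N_T(B)%G \proper T by rewrite properE subsetIl.
  have /properP[_ [g]] := nilpotent_proper_norm (pgroup_nil pT) ltN.
  case/setIP=> Tg Ng; case/negP; rewrite inE Tg; apply/normP.
  rewrite -[B :^ g]/((fun x => x ^ g) @: B).
  apply: (rigid_im cBB rN).
  - by move=> x y _ _; rewrite conjMg.
  - by move=> x y _ _; apply: conjg_inj.
  by rewrite -(normP Ng); apply: imsetS (normal_sub nBN).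
have NT : 'N_T(B)%G = T.
  by apply: val_inj; apply/setIidPl; apply: normal_norm.
by apply: (rigid_fnormal pT satF nBT cBB); rewrite -NT.
Qed.

End Transport.

(** * Realizability and the theorem *)

Lemma realizable_acts_like (gT hT : finGroupType) (S A : {group gT})
    (Gamma : {group {perm gT}}) (T : {group hT}) (i : {morphism A >-> hT})
    (inji : 'injm i) (F : fusion_system T) :
    A <| S -> Gamma \subset Aut A -> 2.-Sylow(Gamma) (AutS S A) -> 2.-group T ->
    i @* A \subset T ->
    AutF F (i @* A)%G = Aut_isom inji (subxx A) @: Gamma ->
  exists j : gT -> hT,
    [/\ {in A &, {morph j : x y / x * y}}, {in A &, injective j},
        j @: A = i @* A & acts_like S A j 'N_T(i @* A)%G].
Proof.
move=> nAS sGA sylS pT sBT AutFE_; set B := (i @* A)%G in AutFE_ *.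
(* [X] is Aut_T(B) pulled back to [Gamma], a 2-group, so Sylow's theorem conjugates it by some [c]
   into Aut_S(A). *)
pose X := (Aut_isom inji (subxx A) @*^-1 AutS T B :&: Gamma)%G.
have XG : X \subset Gamma by apply: subsetIr.
have pB : 2.-group (AutS T B).
  by apply: morphim_pgroup; apply: pgroupS pT; apply: subsetIl.
have injI : 'injm (Aut_isom_morphism inji (subxx A)) by apply: injm_Aut_isom.
have pX : 2.-group X.
  have XA : X \subset Aut A := subset_trans XG sGA.
  rewrite -(injm_pgroup injI _ XA).
  apply: pgroupS pB; apply/subsetP=> _ /morphimP[a _ /setIP[/morphpreP[_ Xa] _] ->].
  exact: Xa.
have sylSA : 2.-Sylow(Gamma) (conj_aut A @* 'N_S(A))%G := sylS.
have [c Gc sXS] := Sylow_Jsub sylSA XG pX.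
have Ac : c \in Aut A by apply: (subsetP sGA).
have Aci : c^-1 \in Aut A by rewrite groupV.
have cA a : a \in A -> c^-1 a \in A by move=> Aa; rewrite Aut_closed.
(* Twisting [i] by [c^-1] absorbs this conjugation: [a] in [X] then acts through [a ^ c], which lies
   in Aut_S(A). *)
exists (fun a => i (c^-1 a)); split.
- move=> a b Aa Ab /=; rewrite -(morphM i) ?cA //.
  by rewrite (morphicP (Aut_morphic Aci)).
- by move=> a b Aa Ab /= /(injmP inji) => /(_ (cA _ Aa) (cA _ Ab)) /perm_inj.
- rewrite [RHS]morphimEdom (imset_comp i c^-1).
  suffices -> : c^-1 @: A = A by [].
  by rewrite -{2}(im_autm Aci) morphimEdom; apply: eq_imset => a; rewrite /= autmE.
move=> g NTg; have [Tg Ng] := setIP NTg.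
have : conj_aut B g \in AutF F B.
  by apply: (subsetP (AutS_AutF F sBT)); apply: mem_morphim.
rewrite AutFE_ => /imsetP[a Ga ag].
have Aa : a \in Aut A by apply: (subsetP sGA).
have Xa : a \in X.
  rewrite inE Ga andbT mem_morphpre //= -ag.
  by apply: mem_morphim.
have : a ^ c \in AutS S A by apply: (subsetP sXS); rewrite memJ_conjg.
case/morphimP=> g' Ng' /setIP[Sg' _] acE; exists g' => // b Ab.
have iB : i (c^-1 b) \in B by rewrite mem_morphim ?cA.
rewrite -(norm_conj_autE Ng iB) ag Aut_isomE ?cA //; congr (i _).
by rewrite -(norm_conj_autE Ng' Ab) -acE conjgE !permM permK.
Qed.

Theorem theoremB (n : nat) (hn : (3 <= n)%N) (gT : finGroupType)
  (S A : {group gT}) (v1 v2 v3 s t : gT)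
  (hA : <[v1]> \x <[v2]> \x <[v3]> = A)
  (o1 : #[v1] = (2 ^ n)%N) (o2 : #[v2] = (2 ^ n)%N) (o3 : #[v3] = (2 ^ n)%N)
  (hS : A <*> <<[set s; t]>> = S)
  (hAS : A <| S)
  (hD8 : S / A \isog 'D_8)
  (ht1 : v1 ^ t = v3^-1) (ht2 : v2 ^ t = v2^-1) (ht3 : v3 ^ t = v1^-1)
  (hs1 : v1 ^ s = v2) (hs2 : v2 ^ s = v3) (hs3 : v3 ^ s = v1 * v2^-1 * v3)
  (htt : t ^+ 2 = 1)
  (hss : s ^+ 4 \in <[v1 * v3]>) :
  (forall F : fusion_system S, saturated 2 F -> fnormal F A) /\
  ~ (exists Gamma : {group {perm gT}},
       [/\ Gamma \subset Aut A,
           2.-Sylow(Gamma) (AutS S A)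
         & fusion_realizable 2 A Gamma]).
Proof.
have oSA : #|S / A| = 8 by rewrite (card_isog hD8) (@card_2dihedral 3).
have cA := lattice_abelian hn hA o1 o2 o3.
have CA := lattice_cent hn hA o1 o2 o3 hS hAS oSA ht1 ht2 ht3 hs1 hs2 hs3.
have rSA := rigid_lattice hn hA o1 o2 o3 hS hAS oSA ht1 ht2 ht3 hs1 hs2 hs3.
split=> [F satF|[Gamma [sGA sylS]]].
  have pS : 2.-group S.
    rewrite /pgroup -(Lagrange (normal_sub hAS)) -card_quotient ?normal_norm //.
    have [[B _ B12 _] _ _ _] := dprodP hA; rewrite B12 in hA.
    by rewrite oSA -(dprod_card hA) -(dprod_card B12) -!orderE o1 o2 o3 !pnatM !pnatX.
  (* The system over [S] itself is the case of the identity transport. *)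
  apply: (transport_fnormal (j := id) hAS CA cA rSA _ _ _ pS satF) => //.
  - exact: imset_id.
  - exact: normal_sub.
  by move=> g /setIP[Sg _]; exists g.
case=> [hT [T [i [inji [F [[pT satF] BT CB nF AutFB]]]]]].
have [j [jM inj_j jA actj]] := realizable_acts_like hAS sGA sylS pT BT AutFB.
exact: nF (transport_fnormal hAS CA cA rSA jM inj_j jA pT satF BT CB actj).
Qed.
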